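(* For any partition $\lambda$, there exists an effectively computable integer $t_\lambda\ge0$ such that $A^{\lambda[n]}_{\mathrm{id}_k}\ge0$ for all integers $n\ge k\ge t_\lambda$.
   Context: For $\pi\in S_n$ and $k\ge0$, $N_{\mathrm{id}_k}(\pi)$ is the number of index sequences $1\le i_1<\dots<i_k\le n$ with $\pi(i_1)<\dots<\pi(i_k)$ (so $N_{\mathrm{id}_0}(\pi)=1$). For $j\ge1$, $m_j:\bigsqcup_{n\ge0}S_n\to\mathbb{Z}_{\ge0}$ is the function counting $j$-cycles of a permutation; for a partition $\rho$, $m_j(\rho)$ is the number of parts of size $j$, and $I_\rho:=\prod_{j\ge1}\binom{m_j}{m_j(\rho)}\in\mathbb{Q}[m_1,m_2,\dots]$. For partitions $\mu,\rho$ of the same size, $\chi^\mu_\rho$ is the value of the irreducible symmetric group character $\chi^\mu$ on permutations of cycle type $\rho$. Put $Y^\mu:=\sum_{\rho\vdash|\mu|}\chi^\mu_\rho I_\rho$ and $X^\lambda:=\sum_{\mu\prec'\lambda}(-1)^{|\lambda|-|\mu|}Y^\mu$, where $\mu\prec'\lambda$ means that $\mu$ is a partition obtained from $\lambda$ by removing at most one box in each row. (By a theorem of Macdonald, $X^\lambda(\pi)=\chi^{\lambda[n]}(\pi)$ for $\pi\in S_n$ with $n\ge|\lambda|+\lambda_1$, where $\lambda[n]=(n-|\lambda|,\lambda_1,\lambda_2,\dots)$.) For all $n,k\ge0$ define $A^{\lambda[n]}_{\mathrm{id}_k}:=\frac1{n!}\sum_{\pi\in S_n}X^\lambda(\pi)N_{\mathrm{id}_k}(\pi)$.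 *)

(* Defs.v *)
From mathcomp Require Import all_boot all_order all_algebra all_fingroup.
From mathcomp Require Import all_solvable all_field all_character.
Set Implicit Arguments.
Unset Strict Implicit.
Unset Printing Implicit Defensive.
Import Order.TTheory GRing.Theory Num.Theory.
Local Open Scope ring_scope.

(* A partition is the weakly decreasing sequence of its (positive) parts. *)
Definition is_part (la : seq nat) : bool := sorted geq la && (0%N \notin la).

Definition is_part_of (m : nat) (la : seq nat) : bool :=
  is_part la && (sumn la == m).

(* A partition of m has at most m parts, all of them at most m, so the
   enumeration below is exhaustive; see mem_parts and parts_uniq. *)
Definition parts (m : nat) : seq (seq nat) :=
  [seq s <- [seq map val (r : seq 'I_m.+1) | r : {bseq m of 'I_m.+1}]
     | is_part_of m s].

Lemma parts_uniq m : uniq (parts m).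
Proof.
rewrite filter_uniq // map_inj_uniq ?enum_uniq // => r1 r2 eq12.
by apply: val_inj; apply: (inj_map val_inj).
Qed.

Lemma mem_parts m s : (s \in parts m) = is_part_of m s.
Proof.
rewrite mem_filter; have [/andP[/andP[_ s0] /eqP sm] /=|//] := boolP (is_part_of m s).
have le_sz: (size s <= m)%N.
  rewrite -sm; elim: s s0 {sm} => //= x s IHs.
  by rewrite inE negb_or -add1n => /andP[x0 /IHs]; apply: leq_add; rewrite lt0n eq_sym.
have le_m: {in s, forall x, (x < m.+1)%N}.
  rewrite -sm => x; elim: s {s0 sm le_sz} => //= y s IHs.
  rewrite inE ltnS => /predU1P[->|/IHs]; first exact: leq_addr.
  by rewrite ltnS => /leq_trans-> //; apply: leq_addl.
have szr: (size [seq inord x : 'I_m.+1 | x <- s] <= m)%N by rewrite size_map.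
apply/mapP; exists (Bseq szr); rewrite ?mem_enum //=.
by rewrite -map_comp map_id_in // => x /le_m xm /=; rewrite inordK.
Qed.

(* mu is obtained from la by removing at most one box in each row. *)
Definition vstrip (mu la : seq nat) : bool :=
  is_part mu &&
  [forall i : 'I_(maxn (size mu) (size la)),
     (nth 0%N mu i <= nth 0%N la i <= (nth 0%N mu i).+1)%N].

Definition ncycles (j n : nat) (s : 'S_n) : nat :=
  #|[set c in porbits s | #|c| == j]|.

Definition cycle_type (n : nat) (s : 'S_n) : seq nat :=
  sort geq [seq #|c| | c : {set 'I_n} in porbits s].

(* The standard tableau of shape mu used here is the one filled row by row
   with 0, 1, ..., |mu| - 1: i sits in row (reshape_index mu i) and column
   (reshape_offset mu i). *)
Definition row_stab (mu : seq nat) : {set 'S_(sumn mu)} :=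
  [set s : 'S_(sumn mu) | [forall i, reshape_index mu (s i) == reshape_index mu i]].

Definition col_stab (mu : seq nat) : {set 'S_(sumn mu)} :=
  [set s : 'S_(sumn mu) | [forall i, reshape_offset mu (s i) == reshape_offset mu i]].

Definition Sgrp (n : nat) : {group 'S_n} := [set: 'S_n]%G.

(* Young symmetrizer, as an element of the group algebra algC[S_|mu|], whose
   underlying vector space is that of the regular representation. *)
Definition young_symmetrizer (mu : seq nat) : 'rV[algC]_#|Sgrp (sumn mu)| :=
  \sum_(p in row_stab mu) \sum_(q in col_stab mu)
     (-1) ^+ (q : bool) *: delta_mx 0 (gring_index (Sgrp (sumn mu)) (p * q)%g).

(* The Specht module of mu. The regular representation acts by right
   multiplication and (p * q) x = q (p x), so that in terms of composition of
   functions this is the left ideal generated by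
   (signed column sum) o (row sum); mu = [:: n] gives the trivial module and
   mu = nseq n 1 the sign module. *)
Definition specht_mx (mu : seq nat) : 'M[algC]_#|Sgrp (sumn mu)| :=
  cyclic_mx (regular_repr algC (Sgrp (sumn mu))) (young_symmetrizer mu).

Definition chi (mu : seq nat) : 'CF(Sgrp (sumn mu)) :=
  cfRepr (submod_repr
    (cyclic_mx_module (regular_repr algC (Sgrp (sumn mu)))
       (young_symmetrizer mu) : mxmodule _ (specht_mx mu))).

(* Value of chi mu on the permutations of cycle type rho; the default 0 is
   only used when rho is not a partition of |mu|. *)
Definition chi_val (mu rho : seq nat) : algC :=
  if [pick s : 'S_(sumn mu) | cycle_type s == rho] is Some s
  then chi mu s else 0.

(* The factors with j > |rho| are all equal to 1. *)
Definition Ibin (rho : seq nat) (n : nat) (s : 'S_n) : nat :=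
  (\prod_(1 <= j < (sumn rho).+1) 'C(ncycles j s, count_mem j rho))%N.

Definition Y (mu : seq nat) (n : nat) (s : 'S_n) : algC :=
  \sum_(rho <- parts (sumn mu)) chi_val mu rho * (Ibin rho s)%:R.

Definition X (la : seq nat) (n : nat) (s : 'S_n) : algC :=
  \sum_(0 <= m < (sumn la).+1) \sum_(mu <- parts m | vstrip mu la)
     (-1) ^+ (sumn la - sumn mu) * Y mu s.

Definition Nid (k n : nat) (s : 'S_n) : nat :=
  #|[set t : k.-tuple 'I_n | sorted (relpre val ltn) t
                             && sorted (relpre (fun i => val (s i)) ltn) t]|.

Definition A (la : seq nat) (n k : nat) : algC :=
  (n`!%:R)^-1 * \sum_(s : 'S_n) X la s * (Nid k s)%:R.

(* Total recursive functions nat^n -> nat: the closure of the basic functions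
   under composition, primitive recursion and minimization of regular
   functions. *)
Inductive recursive : forall n : nat, (n.-tuple nat -> nat) -> Prop :=
| rec_zero n (h : n.-tuple nat -> nat) :
    (forall v, h v = 0%N) -> recursive h
| rec_succ (h : 1.-tuple nat -> nat) :
    (forall v, h v = (tnth v ord0).+1) -> recursive h
| rec_proj n (i : 'I_n) (h : n.-tuple nat -> nat) :
    (forall v, h v = tnth v i) -> recursive h
| rec_comp m n (f : m.-tuple nat -> nat) (g : 'I_m -> n.-tuple nat -> nat)
    (h : n.-tuple nat -> nat) :
    recursive f -> (forall i, recursive (g i)) ->
    (forall v, h v = f [tuple g i v | i < m]) -> recursive h
| rec_prim n (f : n.-tuple nat -> nat) (g : n.+2.-tuple nat -> nat)
    (h : n.+1.-tuple nat -> nat) :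
    recursive f -> recursive g ->
    (forall v : n.-tuple nat, h [tuple of 0%N :: v] = f v) ->
    (forall y (v : n.-tuple nat),
       h [tuple of y.+1 :: v]
       = g [tuple of y :: h [tuple of y :: v] :: v]) ->
    recursive h
| rec_mu n (f : n.+1.-tuple nat -> nat) (h : n.-tuple nat -> nat) :
    recursive f ->
    (forall v : n.-tuple nat, f [tuple of h v :: v] = 0%N) ->
    (forall (v : n.-tuple nat) y, (y < h v)%N -> f [tuple of y :: v] != 0%N) ->
    recursive h.

(* Computability of a function on finite sequences of natural numbers, through
   the effective bijection CodeSeq.code : seq nat -> nat. *)
Definition computable (t : seq nat -> nat) : Prop :=
  exists2 f : 1.-tuple nat -> nat,
    recursive f & forall s, t s = f [tuple CodeSeq.code s].

(* Main.v *)
(* Let l colours colour {1..n}. For a weight mu, alpha^mu(s) is the sum over the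
   s-invariant colourings c of the Jacobi-Trudi determinant
   det [content_i(c) + i = mu_i + j], i.e. the coefficient of x^(mu + delta) in
   a_delta(x) times the power sum product of the cycle type of s. Pieri's rule
   gives <alpha^mu, M^b> = [b = mu] for the weights b of the determinant
   expansion (M^b is induced from the trivial character of a Young subgroup),
   so for a partition alpha^mu has norm 1 and is irreducible. Since alpha^mu
   and M^mu have the same pairing with the signed column sums, alpha^mu is the
   only common constituent of M^mu and of the induced sign character, hence the
   character of the Specht module. Column operations on the determinant then
   identify X^la with alpha^(la[n]) when n >= |la| + la_1. Finally the function
   N_id_k is of positive type, so that its pairing with an irreducible
   character is nonnegative: la |-> code la >= |la| + la_1 is a valid bound. *)
Require Import Defs.
From mathcomp Require Import all_boot all_order all_algebra all_fingroup.
From mathcomp Require Import all_solvable all_field all_character.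
From mathcomp Require Import zify.
Set Implicit Arguments.
Unset Strict Implicit.
Unset Printing Implicit Defensive.
Import Order.TTheory GRing.Theory Num.Theory.
Local Open Scope ring_scope.

(** * Colourings *)

(** [X] reaches S_n through characters of the smaller groups S_|mu|, evaluated on chosen sets of
    cycles of s, and these characters are traces on Specht modules, so its definition does not
    exhibit a character of S_n. The bridge is a formula meaningful for any list of cycle lengths: a
    sum over invariant colourings is a sum over colourings of the cycles. Choosing some cycles and
    colouring them with l colours amounts to colouring all cycles with l + 1 colours, the unchosen
    ones receiving the additional colour; this colour becomes the first row of la[n]. Three
    vanishing arguments (terms that are not interlaced, colours repeated in a column, non-partitions
    left by removing boxes) all exchange two entries by a transposition. The bound is the code
    itself because, seen through the coding, it is a mere projection; as k <= n, it forces n >= |la|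
    + la_1. *)

Definition content (I : finType) n (c : {ffun 'I_n -> I}) : {ffun I -> nat} :=
  [ffun i => #|[set x | c x == i]|].

Definition pfix (I : finType) n (s : 'S_n) (c : {ffun 'I_n -> I}) : bool :=
  [forall x, c (s x) == c x].

(** The Young subgroup attached to the colour classes of c. *)
Definition stabc (I : finType) n (c : {ffun 'I_n -> I}) : {set 'S_n} :=
  [set s | pfix s c].

Lemma pfixP (I : finType) n (s : 'S_n) (c : {ffun 'I_n -> I}) :
  reflect (forall x, c (s x) = c x) (pfix s c).
Proof. by apply: (iffP forallP) => h x; apply/eqP; have:= h x; move/eqP. Qed.

Lemma stabc_group (I : finType) n (c : {ffun 'I_n -> I}) :
  group_set (stabc c).
Proof.
apply/group_setP; split=> [|s t]; rewrite !inE.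
  by apply/pfixP=> x; rewrite perm1.
by move=> /pfixP cs /pfixP ct; apply/pfixP=> x; rewrite permM ct cs.
Qed.
Canonical stabc_Group (I : finType) n (c : {ffun 'I_n -> I}) :=
  Group (stabc_group c).

Lemma sum_content (I : finType) n (c : {ffun 'I_n -> I}) :
  (\sum_i content c i)%N = n.
Proof.
rewrite -[RHS]card_ord -sum1_card (partition_big c xpredT) //=.
by apply: eq_bigr => i _; rewrite ffunE -sum1_card; apply: eq_bigl=> x; rewrite inE.
Qed.

Lemma content_count (I : finType) n (c : {ffun 'I_n -> I}) i :
  content c i = count_mem i [tuple c x | x < n].
Proof.
rewrite ffunE /= count_map -sum1_count big_enum_cond /= -sum1_card.
by apply: eq_bigl => x /=; rewrite inE.
Qed.

Lemma content_perm (I : finType) n (c d : {ffun 'I_n -> I}) :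
  content c = content d -> exists s : 'S_n, forall x, c x = d (s x).
Proof.
move=> cd; have /tuple_permP[s Hs] :
    perm_eq [tuple c x | x < n] [tuple d x | x < n].
  by apply/allP => i _ /=; rewrite -!content_count cd.
exists s => x; have /(congr1 (fun t => tnth t x)) := val_inj Hs.
by rewrite !tnth_mktuple.
Qed.

Lemma content_pfix (I : finType) n (c d : {ffun 'I_n -> I}) (s : 'S_n) :
  (forall x, c x = d (s x)) -> content c = content d.
Proof.
move=> cd; apply/ffunP=> i; rewrite !ffunE -[RHS](card_preimset _ (@perm_inj _ s)).
by apply: eq_card => x; rewrite !inE cd.
Qed.

Lemma content_ex (I : finType) n (a : {ffun I -> nat}) :
  (\sum_i a i)%N = n -> exists c : {ffun 'I_n -> I}, content c = a.
Proof.
move=> an; pose q := flatten [seq nseq (a i) i | i <- enum I].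
have q_sz : size q == n.
  rewrite size_flatten /shape -map_comp sumnE big_map big_enum /= -an.
  by apply/eqP/eq_bigr => i _; rewrite size_nseq.
exists [ffun x => tnth (Tuple q_sz) x]; apply/ffunP=> i.
rewrite content_count.
have -> : [tuple [ffun x => tnth (Tuple q_sz) x] x | x < n] = Tuple q_sz.
  by apply: eq_from_tnth => x; rewrite tnth_mktuple ffunE.
rewrite /= count_flatten -map_comp sumnE big_map big_enum /= (bigD1 i) //=.
rewrite count_nseq /= eqxx mul1n big1 ?addn0 // => j /negPf ji.
by rewrite count_nseq /= ji.
Qed.

(** The permutations carrying one colouring to the other form a right coset of the first stabiliser
    and a left coset of the second. *)
Lemma card_transport (I : finType) n (c d : {ffun 'I_n -> I}) :
  content c = content d ->
  #|[set s : 'S_n | [forall x, c x == d (s x)]]| = #|stabc c|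
  /\ #|stabc c| = #|stabc d|.
Proof.
case/content_perm=> s0 cd.
have -> : [set s : 'S_n | [forall x, c x == d (s x)]] = (stabc c :* s0)%g.
  apply/setP=> s; rewrite mem_rcoset !inE.
  apply/forallP/pfixP => h x; last by rewrite -(h x) cd permM permKV.
  by rewrite cd permM permKV -(eqP (h x)).
rewrite card_rcoset; split=> //.
suff e : (s0 *: stabc d)%g = (stabc c :* s0)%g.
  by rewrite -(card_rcoset _ s0) -e card_lcoset.
apply/setP=> s; rewrite mem_lcoset mem_rcoset !inE.
apply/pfixP/pfixP => h x; last first.
  by have := h (s0^-1 x)%g; rewrite permM !cd !permKV => <-; rewrite permM.
by have := h (s0 x); rewrite !permM permK !cd permKV.
Qed.

(** Orbit counting: S_n is split according to the colouring d o s, and each fibre is a transporter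
    of the size given by [card_transport]. *)
Lemma sum_card_stabc (I : finType) n (a : {ffun I -> nat}) :
  (\sum_i a i)%N = n ->
  (\sum_(c : {ffun 'I_n -> I} | content c == a) #|stabc c|)%N = n`!.
Proof.
case/content_ex => d <-; rewrite -card_Sn -sum1_card.
pose f (s : 'S_n) := [ffun x => d (s x)].
rewrite [RHS](partition_big f (fun c => content c == content d)) /=; last first.
  by move=> s _; apply/eqP/(@content_pfix _ _ _ _ s) => x; rewrite ffunE.
apply: eq_bigr => c /eqP/card_transport[<- _]; rewrite -sum1_card.
apply: eq_bigl => s; rewrite !inE eq_sym.
apply/forallP/eqP => [h|/ffunP h x]; last by rewrite h ffunE.
by apply/ffunP => x; rewrite ffunE (eqP (h x)).
Qed.

(** Leaves for each colouring a weighted sum over its stabiliser: with weight 1 this gives Burnside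
    counting, with the sign on a column group it gives cancellation. *)
Lemma sum_perm_colorings (R : nzSemiRingType) (I : finType) n
    (P : pred 'S_n) (g : 'S_n -> R) (F : {ffun I -> nat} -> R) :
  \sum_(s | P s) g s * \sum_(c : {ffun 'I_n -> I} | pfix s c) F (content c)
  = \sum_c (\sum_(s in stabc c | P s) g s) * F (content c).
Proof.
under eq_bigr do rewrite mulr_sumr big_mkcond.
rewrite exchange_big /=; apply: eq_bigr => c _.
rewrite mulr_suml -big_mkcondr /=; apply: eq_big => [s|//].
by rewrite inE andbC.
Qed.

(* Burnside counting: the orbits of S_n on the colourings of 'I_n by I are the
   contents. *)
Lemma orbit_sum (I : finType) n N (F : {ffun I -> nat} -> algC) :
  (n <= N)%N ->
  \sum_(s : 'S_n) \sum_(c : {ffun 'I_n -> I} | pfix s c) F (content c)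
  = n`!%:R * \sum_(a : {ffun I -> 'I_N.+1} | (\sum_i a i == n)%N)
               F [ffun i => val (a i)].
Proof.
move=> n_N.
under eq_bigr => s _ do rewrite -[\sum_(c | _) _]mul1r.
rewrite (sum_perm_colorings xpredT (fun=> 1)).
pose lo (c : {ffun 'I_n -> I}) : {ffun I -> 'I_N.+1} := [ffun i => inord (content c i)].
have loE c : [ffun i => val (lo c i)] = content c.
  apply/ffunP=> i; rewrite ffunE /= [lo c i]ffunE inordK // ltnS.
  by apply: leq_trans n_N; rewrite -[leqRHS](sum_content c) (bigD1 i) //= leq_addr.
rewrite (partition_big lo (fun a : {ffun I -> 'I_N.+1} => \sum_i a i == n)%N) /=; last first.
  move=> c _; apply/eqP; rewrite -[RHS](sum_content c); apply: eq_bigr => i _.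
  by rewrite -[in RHS]loE ffunE.
rewrite mulr_sumr; apply: eq_bigr => a /eqP an.
have an' : (\sum_i [ffun i => val (a i)] i)%N = n.
  by rewrite -[RHS]an; apply: eq_bigr => i _; rewrite ffunE.
rewrite -(sum_card_stabc an') natr_sum mulr_suml.
apply: eq_big => [c|c /eqP ca]; last first.
  by under eq_bigl do rewrite andbT; rewrite -loE ca sumr_const.
by rewrite -loE; apply/eqP/eqP => [->//|/ffunP h]; apply/ffunP=> i; have:= h i; rewrite !ffunE => /val_inj.
Qed.

(** * Pieri's rule *)

(* alt0 g is the coefficient of x^g in a_delta(x), and pieri_coef b m g that in
   a_delta(x) h_(b 0)(x) ... h_(b (m - 1))(x). *)
Definition alt0 l N (g : {ffun 'I_l -> 'I_N}) : algC :=
  \det (\matrix_(i, j < l) (g i == rev_ord j :> nat)%:R).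

Fixpoint pieri_coef l N (b : nat -> nat) m (g : {ffun 'I_l -> 'I_N}) : algC :=
  if m is m'.+1 then
    \sum_(h : {ffun 'I_l -> 'I_N} |
          [forall i, h i <= g i]%N && (\sum_i h i + b m' == \sum_i g i)%N)
       pieri_coef b m' h
  else alt0 g.

(** The exponents mu + delta of partitions mu, where delta_i = l - 1 - i is [rev_ord i]. *)
Definition strict_dec l N (g : {ffun 'I_l -> 'I_N}) :=
  forall i j : 'I_l, (i < j)%N -> (g j < g i)%N.

Definition permV l N (s : 'S_l) (g : {ffun 'I_l -> 'I_N}) : {ffun 'I_l -> 'I_N} :=
  [ffun i => g (s i)].

Lemma permVK l N (s : 'S_l) : cancel (@permV l N s) (permV s^-1).
Proof. by move=> g; apply/ffunP=> i; rewrite !ffunE permKV. Qed.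

Lemma permV_bij l N (s : 'S_l) : bijective (@permV l N s).
Proof.
exists (permV s^-1) => [|g]; first exact: permVK.
by apply/ffunP=> i; rewrite !ffunE permK.
Qed.

Lemma sum_permV l N (s : 'S_l) (g : {ffun 'I_l -> 'I_N}) :
  (\sum_i permV s g i = \sum_i g i)%N.
Proof.
rewrite [RHS](reindex_inj (@perm_inj _ s)) /=.
by apply: eq_bigr => i _; rewrite ffunE.
Qed.

(** The polynomial in question is the alternating a_delta times symmetric factors. *)
Lemma pieri_coef_perm l N b m (s : 'S_l) (g : {ffun 'I_l -> 'I_N}) :
  pieri_coef b m (permV s g) = (-1) ^+ s * pieri_coef b m g.
Proof.
elim: m g => [|m IHm] g /=.
  rewrite -det_perm -det_mulmx -row_permE; congr (\det _).
  by apply/matrixP=> i j; rewrite !mxE ffunE.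
rewrite mulr_sumr (reindex _ (onW_bij _ (permV_bij N s))) /=.
apply: eq_big => [h|h _]; last exact: IHm.
rewrite !sum_permV; congr (_ && _); apply/forallP/forallP => h_g i.
  by have := h_g (s^-1 i)%g; rewrite !ffunE permKV.
by rewrite !ffunE.
Qed.

(** For g = mu + delta and h = nu + delta this is mu_(i+1) <= nu_i; together with h <= g it makes
    mu/nu a horizontal strip. The row i is a plain number, so that the condition is vacuous once i +
    1 is not a row. *)
Definition interl l N (g h : {ffun 'I_l -> 'I_N}) (i : nat) : bool :=
  [forall k : 'I_l, forall j : 'I_l,
     (val k == i) ==> (val j == i.+1) ==> (g j < h k)%N].

Lemma interlP l N (g h : {ffun 'I_l -> 'I_N}) (i : nat) :
  reflect (forall k j : 'I_l, val k = i -> val j = i.+1 -> (g j < h k)%N)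
          (interl g h i).
Proof.
apply: (iffP forallP) => [H k j ki ji|H k].
  by have /forallP/(_ j) := H k; rewrite ki ji !eqxx.
by apply/forallP => j; apply/implyP => /eqP ki; apply/implyP=> /eqP ji; apply: H.
Qed.

Lemma eq_oppr0 (x : algC) : x = - x -> x = 0.
Proof.
move=> xN; have : x *+ 2 == 0 by rewrite mulr2n {2}xN subrr.
by rewrite mulrn_eq0 => /eqP.
Qed.

Definition pieri_base l N (g h : {ffun 'I_l -> 'I_N}) (r : nat) : bool :=
  [forall i, h i <= g i]%N && (\sum_i h i + r == \sum_i g i)%N.

(* The terms which are not interlaced cancel: exchanging the entries of h at
   the first defect t and at t + 1 is a sign reversing involution. *)
Lemma pieri_interl_upto l N b m (g : {ffun 'I_l -> 'I_N}) t :
  strict_dec g ->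
  pieri_coef b m.+1 g =
  \sum_(h | pieri_base g h (b m) && [forall i : 'I_t, interl g h i])
     pieri_coef b m h.
Proof.
move=> g_dec; elim: t => [|t IHt].
  by apply: eq_bigl => h; rewrite -[LHS]andbT; congr (_ && _); apply/esym/forallP => -[].
rewrite IHt (bigID (fun h => interl g h t)) /= addrC [X in X + _](_ : _ = 0) ?add0r.
  apply: eq_bigl => h; rewrite -andbA; congr (_ && _).
  apply/andP/forallP => [[/forallP h_lt ht] i|h_lt].
    have := ltn_ord i; rewrite ltnS leq_eqVlt => /predU1P[->//|i_t].
    exact: (h_lt (Ordinal i_t)).
  split; last exact: (h_lt ord_max).
  by apply/forallP => i; have := h_lt (widen_ord (leqnSn t) i).
have [/existsP[k /existsP[j /andP[/eqP kt /eqP jt]]]|no_kj] :=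
  boolP [exists k : 'I_l, exists j : 'I_l, (val k == t) && (val j == t.+1)]; last first.
  rewrite big_pred0 // => h; apply/negP => /andP[_ /negP[]].
  apply/interlP => k j kt jt; case/negP: no_kj.
  by apply/existsP; exists k; apply/existsP; exists j; rewrite kt jt !eqxx.
pose s := tperm k j; pose B h := pieri_base g h (b m)
  && [forall i : 'I_t, interl g h i] && ~~ interl g h t.
have kj : (k < j)%N by rewrite kt jt.
have k_neq_j : k != j by rewrite -val_eqE /= neq_ltn kj.
have badE h : ~~ interl g h t = (h k <= g j)%N.
  rewrite leqNgt; congr (~~ _); apply/interlP/idP => [-> //|h_kj k' j' k't j't].
  by have -> : k' = k by [apply: val_inj; rewrite kt]; have -> : j' = j by [apply: val_inj; rewrite jt].
(* A defect says h k <= g j < g k, so the exchanged entries stay below g. The defect persists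
   because h j <= g j, and the conditions at rows i < t only involve h i, which is not moved. *)
have sB h : B h -> B (permV s h).
  rewrite /B /pieri_base !badE -!andbA => /and4P[/forallP h_g h_sum /forallP h_lt h_kj].
  rewrite sum_permV h_sum /=; apply/and3P; split.
  - apply/forallP=> i; rewrite ffunE /s; case: tpermP => [->|->|_ _] //.
      exact: leq_trans (h_g j) (ltnW (g_dec _ _ kj)).
  - apply/forallP=> i; apply/interlP => k' j' k'i j'i.
    have i_t := ltn_ord i.
    rewrite ffunE tpermD; first by have /interlP := h_lt i; apply.
      by rewrite -val_eqE /= kt k'i; lia.
    by rewrite -val_eqE /= jt k'i; lia.
  - by rewrite ffunE tpermL.
apply: eq_oppr0; rewrite -[LHS]/(\sum_(h | B h) _) -[in RHS]/(\sum_(h | B h) _).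
rewrite [LHS](reindex _ (onW_bij _ (permV_bij N s))) /= -sumrN.
apply: eq_big => [h|h _]; last by rewrite pieri_coef_perm odd_tperm k_neq_j mulN1r.
apply/idP/idP => [/sB|/sB//]; congr B; apply/ffunP=> i.
by rewrite !ffunE tpermK.
Qed.

Lemma strict_dec_gap l N (g : {ffun 'I_l -> 'I_N}) (i j : 'I_l) :
  strict_dec g -> (i <= j)%N -> (g j + (j - i) <= g i)%N.
Proof.
move=> g_dec; move: {2}(j - i)%N (erefl (j - i)%N) => d.
elim: d j => [|d IHd] j ji ij.
  have -> : j = i by apply: val_inj; apply/eqP; rewrite eqn_leq ij andbT -subn_eq0 ji.
  by rewrite subnn addn0.
have j_gt0 : (0 < j)%N by move: ij ji; case: (val j) => //; case: (val i).
have j1 : (j.-1 < l)%N by apply: leq_ltn_trans (ltn_ord j); apply: leq_pred.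
have d_j : (Ordinal j1 - i = d)%N by rewrite /= -subn1 subnAC ji subn1.
have i_j : (i <= Ordinal j1)%N by rewrite /= -ltnS prednK // -subn_gt0 ji.
have := IHd _ d_j i_j; rewrite d_j ji addnS -addSn; apply: leq_trans.
by rewrite leq_add2r g_dec //= prednK.
Qed.

Lemma strict_dec_ge l N (g : {ffun 'I_l -> 'I_N}) (i : 'I_l) :
  strict_dec g -> (rev_ord i <= g i)%N.
Proof.
move=> g_dec; have l_gt0 : (l.-1 < l)%N by rewrite prednK // (leq_trans _ (ltn_ord i)).
have i_l : (i <= Ordinal l_gt0)%N by rewrite /= -ltnS prednK // (leq_trans _ (ltn_ord i)).
by have := strict_dec_gap g_dec i_l; have := ltn_ord i; move=> /=; lia.
Qed.

Lemma pieri_interl l N b m (g : {ffun 'I_l -> 'I_N}) :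
  strict_dec g ->
  pieri_coef b m.+1 g =
  \sum_(h | pieri_base g h (b m) && [forall i : 'I_l, interl g h i])
     pieri_coef b m h.
Proof. exact: pieri_interl_upto. Qed.

Lemma interl_strict l N (g h : {ffun 'I_l -> 'I_N}) r :
  strict_dec g -> pieri_base g h r -> [forall i : 'I_l, interl g h i] ->
  strict_dec h.
Proof.
move=> g_dec /andP[/forallP h_g _] /forallP h_lt i j ij.
have i1 : (i.+1 < l)%N by apply: leq_ltn_trans (ltn_ord j).
have /interlP/(_ i (Ordinal i1) erefl erefl) := h_lt i; apply: leq_ltn_trans.
apply: leq_trans (h_g j) _; have [->//|j_neq] := eqVneq j (Ordinal i1).
by rewrite ltnW // g_dec //= ltn_neqAle ij andbT eq_sym.
Qed.

(** Triangularity of the Kostka numbers. Each factor adds a horizontal strip, so m factors reach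
    only the first m rows, and the first t factors must fit into the first t rows. *)
Lemma pieri_coef_dominance l N b m (g : {ffun 'I_l -> 'I_N}) :
  strict_dec g -> (m <= l)%N -> pieri_coef b m g != 0 ->
  [/\ forall i : 'I_l, (m <= i)%N -> g i = rev_ord i :> nat,
      (\sum_i g i = \sum_(k < m) b k + \sum_(i < l) rev_ord i)%N
    & forall t, (t <= m)%N ->
        (\sum_(k < t) b k + \sum_(i < l | i < t) rev_ord i
           <= \sum_(i < l | i < t) g i)%N].
Proof.
elim: m g => [|m IHm] g g_dec m_l; last first.
  rewrite pieri_interl // => g_neq0.
  have [h /andP[/andP[h_base h_int] h_neq0]] : exists h,
      (pieri_base g h (b m) && [forall i : 'I_l, interl g h i]) && (pieri_coef b m h != 0).
    apply/existsP; apply: contra_neqT g_neq0 => /existsPn h0; rewrite big1 // => h hP.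
    by have := h0 h; rewrite hP /= negbK => /eqP.
  have h_dec := interl_strict g_dec h_base h_int.
  have [h_hi h_tot h_dom] := IHm h h_dec (ltnW m_l) h_neq0.
  have /andP[/forallP h_g /eqP h_sum] := h_base.
  (* Row i - 1 of h is still that of delta, and interlacing puts g i strictly below it. *)
  have g_hi (i : 'I_l) : (m < i)%N -> g i = rev_ord i :> nat.
    move=> m_i; apply/eqP; rewrite eqn_leq strict_dec_ge // andbT.
    have i_gt0 : (0 < i)%N by apply: leq_trans m_i.
    have i1 : (i.-1 < l)%N by apply: leq_ltn_trans (ltn_ord i); apply: leq_pred.
    have /forallP/(_ (Ordinal i1))/interlP/(_ (Ordinal i1) i erefl) := h_int.
    have i_eq : val i = (Ordinal i1).+1 by rewrite /= prednK.
    move=> /(_ i_eq); rewrite h_hi /=; last by lia.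
    by have := ltn_ord i; lia.
  have g_tot : (\sum_i g i = \sum_(k < m.+1) b k + \sum_(i < l) rev_ord i)%N.
    by rewrite -h_sum h_tot big_ord_recr /= addnAC.
  split=> // t; rewrite leq_eqVlt => /predU1P[->|]; last first.
    rewrite ltnS => t_m; apply: leq_trans (h_dom t t_m) _.
    by apply: leq_sum => i _; apply: h_g.
  move: g_tot; rewrite (bigID (fun i : 'I_l => (i < m.+1)%N)) /=.
  rewrite [X in (_ = _ + X)%N](bigID (fun i : 'I_l => (i < m.+1)%N)) /= addnA.
  rewrite [X in (_ + X = _)%N](eq_bigr (fun i : 'I_l => (l - i.+1)%N)); last first.
    by move=> i; rewrite -leqNgt => /g_hi.
  by move/addIn => <-.
rewrite /= => g_neq0.
(* A nonzero term of the determinant makes g a rearrangement of delta; strict decrease then leaves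
   only delta. *)
have [w gw] : exists w : 'S_l, forall i, g i = rev_ord (w i) :> nat.
  have /existsP[w /forallP gw] : [exists w : 'S_l, forall i, g i == rev_ord (w i) :> nat].
    apply: contra_neqT g_neq0 => /existsPn no_w; apply: big1 => w _.
    have /forallPn[i gi] := no_w w.
    by rewrite (bigD1 i) //= mxE (negPf gi) mul0r mulr0.
  by exists w => i; apply/eqP.
have g_lo (i : 'I_l) : g i = rev_ord i :> nat.
  apply/eqP; rewrite eqn_leq strict_dec_ge // andbT.
  have l_gt0 : (0 < l)%N by apply: leq_trans (ltn_ord i).
  have := @strict_dec_gap _ _ g (Ordinal l_gt0) i g_dec (leq0n _).
  rewrite (gw (Ordinal l_gt0)) /= subn0 => g_i.
  by have := ltn_ord i; have := ltn_ord (w (Ordinal l_gt0)); lia.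
split=> [i _||t]; [exact: g_lo | by rewrite big_ord0; apply: eq_bigr |].
by rewrite leqn0 => /eqP->; rewrite big_ord0 big_pred0 // => i.
Qed.

(** The Kostka number K_(mu,mu) = 1. Undoing the last factor must reset row m to delta and keep the
    rest: any h that contributes has, by dominance, partial sums at least those of g on the rows
    before m, while h <= g in each row. *)
Lemma pieri_coef_eq1 l N (b : nat -> nat) m (g : {ffun 'I_l -> 'I_N}) :
  strict_dec g -> (m <= l)%N ->
  (forall i : 'I_l, (i < m)%N -> g i = b i + rev_ord i :> nat)%N ->
  (forall i : 'I_l, (m <= i)%N -> g i = rev_ord i :> nat) ->
  pieri_coef b m g = 1.
Proof.
elim: m g => [|m IHm] g g_dec m_l g_lo g_hi.
  rewrite /= /alt0 -[RHS](det1 _ l); congr (\det _); apply/matrixP=> i j.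
  by rewrite !mxE g_hi // val_eqE (inj_eq rev_ord_inj).
pose im : 'I_l := Ordinal m_l.
have im_g : (rev_ord im < N)%N by apply: leq_ltn_trans (ltn_ord (g im)); apply: strict_dec_ge.
pose h0 : {ffun 'I_l -> 'I_N} := [ffun i => if i == im then Ordinal im_g else g i].
have h0_lo (i : 'I_l) : (i < m)%N -> h0 i = (b i + rev_ord i)%N :> nat.
  move=> i_m; have /negPf i_im : i != im by rewrite -val_eqE /= ltn_eqF.
  by rewrite ffunE i_im g_lo // ltnW.
have h0_hi (i : 'I_l) : (m <= i)%N -> h0 i = rev_ord i :> nat.
  by move=> m_i; rewrite ffunE; case: eqVneq => [->//|]; rewrite -val_eqE /= => i_m; rewrite g_hi //; lia.
have h0_base : pieri_base g h0 (b m).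
  apply/andP; split.
    by apply/forallP=> i; rewrite ffunE; case: eqP => [->|//]; apply: strict_dec_ge.
  rewrite (bigD1 im) //= [X in _ == X](bigD1 im) //= ffunE eqxx g_lo //= addnAC.
  by rewrite [(_ + b m)%N]addnC; apply/eqP; congr addn; apply: eq_bigr => i /negPf i_m; rewrite ffunE i_m.
have h0_int : [forall i : 'I_l, interl g h0 i].
  apply/forallP => i; apply/interlP => k j ki ji.
  have kj : (k < j)%N by rewrite ki ji.
  rewrite ffunE; case: eqP => [k_m|_]; last exact: g_dec.
  have {}k_m : val k = m by rewrite k_m.
  have m_j : (m < j)%N by rewrite -k_m.
  by rewrite g_hi //=; have := ltn_ord j; lia.
have h0_dec := interl_strict g_dec h0_base h0_int.
rewrite pieri_interl // (bigD1 h0) ?h0_base //= IHm ?(ltnW m_l) //.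
rewrite big1 ?addr0 // => h /andP[/andP[h_base h_int] h_neq].
apply: contraNeq h_neq => h_neq0.
have h_dec := interl_strict g_dec h_base h_int.
have [h_hi _ h_dom] := pieri_coef_dominance h_dec (ltnW m_l) h_neq0.
have /andP[/forallP h_g _] := h_base.
apply/eqP/ffunP=> i; apply: val_inj; have [m_i|i_m] := leqP m i.
  by rewrite /= h_hi // h0_hi.
rewrite /= h0_lo // -(g_lo i (ltnW i_m)); apply/eqP; rewrite eqn_leq h_g /= leqNgt.
apply/negP => hi_g; have := h_dom i.+1 i_m; rewrite leqNgt => /negP[].
have -> : (\sum_(k < i.+1) b k + \sum_(j < l | j < i.+1) rev_ord j
           = \sum_(j < l | j < i.+1) g j)%N.
  transitivity (\sum_(j < l | j < i.+1) (b j + rev_ord j))%N; last first.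
    by apply: eq_bigr => j j_i; rewrite g_lo // (leq_trans j_i) // ltnW.
  rewrite big_split /=; congr addn.
  by rewrite -(big_ord_widen l) // ltn_ord.
rewrite (bigD1 i) //= [X in (_ < X)%N](bigD1 i) //= -addSn leq_add //.
by apply: leq_sum => j _; apply: h_g.
Qed.

(** * Pieri coefficients as sums over integer matrices *)

Definition fcons (V : finType) n (h : 'I_n.+1) (a : V) (g : {ffun 'I_n -> V}) :
  {ffun 'I_n.+1 -> V} := [ffun i => oapp g a (unlift h i)].

Lemma fcons_lift (V : finType) n (h : 'I_n.+1) (a : V) (g : {ffun 'I_n -> V}) i :
  fcons h a g (lift h i) = g i.
Proof. by rewrite ffunE liftK. Qed.

Lemma fcons_id (V : finType) n (h : 'I_n.+1) (a : V) (g : {ffun 'I_n -> V}) :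
  fcons h a g h = a.
Proof. by rewrite ffunE unlift_none. Qed.

Lemma big_fcons (R : nmodType) (V : finType) n (h : 'I_n.+1)
    (G : {ffun 'I_n.+1 -> V} -> R) :
  \sum_f G f = \sum_a \sum_(g : {ffun 'I_n -> V}) G (fcons h a g).
Proof.
rewrite pair_bigA /= (reindex (fun p => fcons h p.1 p.2)) //=.
exists (fun f => (f h, [ffun i => f (lift h i)])) => [[a g] _|f _] /=.
  by rewrite fcons_id; congr pair; apply/ffunP=> i; rewrite ffunE fcons_lift.
apply/ffunP=> i; rewrite ffunE; case: unliftP => [j ->|->] //=.
by rewrite ffunE.
Qed.

Definition subo N (x : 'I_N) (y : nat) : 'I_N :=
  Ordinal (leq_ltn_trans (leq_subr y x) (ltn_ord x)).

(** All factors are expanded into monomials at once: A k is the exponent taken from h_(b k), and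
    a_delta supplies what remains of g. The second condition makes the truncated subtraction [subo]
    exact. *)
Lemma matrix_pieri l N (b : nat -> nat) m (g : {ffun 'I_l -> 'I_N}) :
  \sum_(A : {ffun 'I_m -> {ffun 'I_l -> 'I_N}} |
        [forall k : 'I_m, \sum_i A k i == b k]%N
        && [forall i, \sum_k A k i <= g i]%N)
     alt0 [ffun i => subo (g i) (\sum_k A k i)]
  = pieri_coef b m g.
Proof.
elim: m g => [|m IHm] g.
  rewrite (big_pred1 [ffun i : 'I_0 => g]) /= => [|A].
    congr alt0; apply/ffunP=> i; rewrite ffunE; apply: val_inj.
    by rewrite /= big_ord0 subn0.
  transitivity true; last by apply/esym/eqP/ffunP=> -[].
  apply/andP; split; first by apply/forallP=> -[].
  by apply/forallP=> i; rewrite big_ord0.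
rewrite big_mkcond (big_fcons ord_max) /=.
(* The complement g - a converts the exponent a of the last factor into the summation variable of
   [pieri_coef]. *)
pose sg (a : {ffun 'I_l -> 'I_N}) : {ffun 'I_l -> 'I_N} := [ffun i => subo (g i) (a i)].
rewrite [RHS](reindex_onto sg sg) /=; last first.
  by move=> h /andP[/forallP h_g _]; apply/ffunP=> i; rewrite !ffunE; apply: val_inj; rewrite /= subKn.
rewrite [RHS]big_mkcond; apply: eq_bigr => a _.
have sgsg : (sg (sg a) == a) = [forall i, a i <= g i]%N.
  apply/eqP/forallP => [<- i|a_g]; first by rewrite !ffunE /= leq_subr.
  by apply/ffunP=> i; rewrite !ffunE; apply: val_inj; rewrite /= subKn.
have sumA (A : {ffun 'I_m -> {ffun 'I_l -> 'I_N}}) i :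
    (\sum_k fcons ord_max a A k i = \sum_k A k i + a i)%N.
  rewrite big_ord_recr /= fcons_id; congr addn; apply: eq_bigr => k _.
  by rewrite -[widen_ord _ _](_ : lift ord_max k = _) ?fcons_lift //; apply/val_inj/lift_max.
have colA (A : {ffun 'I_m -> {ffun 'I_l -> 'I_N}}) :
    [forall k : 'I_m.+1, \sum_i fcons ord_max a A k i == b k]%N
  = (\sum_i a i == b m)%N && [forall k : 'I_m, \sum_i A k i == b k]%N.
  apply/forallP/andP => [h|[am /forallP h] k].
    split; first by have := h ord_max; rewrite fcons_id.
    by apply/forallP=> k; have := h (lift ord_max k); rewrite fcons_lift lift_max.
  have [k' ->|->] := unliftP ord_max k; last by rewrite fcons_id.
  by rewrite fcons_lift lift_max.
rewrite sgsg; have sum_sg : [forall i, a i <= g i]%N ->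
    (\sum_i sg a i + b m == \sum_i g i)%N = (\sum_i a i == b m)%N.
  move=> /forallP a_g; have -> : (\sum_i g i = \sum_i sg a i + \sum_i a i)%N.
    by rewrite -big_split; apply: eq_bigr => i _; rewrite ffunE /= subnK.
  by rewrite eqn_add2l eq_sym.
have sg_g : [forall i, sg a i <= g i]%N.
  by apply/forallP=> i; rewrite ffunE /= leq_subr.
rewrite sg_g -IHm /=; case: ifP => [/andP[sum_a /[dup] a_g' /forallP a_g]|not_base].
  rewrite sum_sg // in sum_a.
  rewrite -big_mkcond; apply: eq_big => [A|A _]; last first.
    congr alt0; apply/ffunP=> i; rewrite !ffunE; apply: val_inj => /=.
    by rewrite sumA addnC subnDA.
  rewrite colA sum_a /=; congr (_ && _); apply: eq_forallb => i.
  by rewrite sumA ffunE /= leq_subRL // addnC.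
rewrite big1 // => A _; case: ifP => // /andP[].
rewrite colA => /andP[sum_a _] /forallP A_g; case/idP: not_base.
have a_g : [forall i, a i <= g i]%N.
  by apply/forallP=> i; apply: leq_trans (A_g i); rewrite sumA leq_addl.
by rewrite a_g sum_sg ?sum_a.
Qed.

(** * Jacobi-Trudi class functions paired with permutation characters *)

Definition jt l (mu a : {ffun 'I_l -> nat}) : algC :=
  \det (\matrix_(i, j < l) (a i + i == mu i + j)%N%:R).

Definition alpha l (mu : {ffun 'I_l -> nat}) n (s : 'S_n) : algC :=
  \sum_(c : {ffun 'I_n -> 'I_l} | pfix s c) jt mu (content c).

(** The equation a_i + i = mu_i + j reads g_i - a_i = l - 1 - j; if a_i > g_i, no j satisfies it and
    row i of the determinant is zero. *)
Lemma jt_alt0 l N (mu a : {ffun 'I_l -> nat}) (g : {ffun 'I_l -> 'I_N}) :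
  (forall i, g i = (mu i + rev_ord i)%N :> nat) ->
  jt mu a = if [forall i, a i <= g i]%N then alt0 [ffun i => subo (g i) (a i)] else 0.
Proof.
move=> g_mu; case: ifP => [/forallP a_g|/negbT/forallPn[i]].
  congr (\det _); apply/matrixP=> i j; rewrite !mxE ffunE /=; congr (nat_of_bool _)%:R.
  have := a_g i; rewrite g_mu /=; have := ltn_ord i; have := ltn_ord j.
  by move=> *; apply/eqP/eqP; lia.
rewrite -ltnNge g_mu => a_g; apply: big1 => s _.
rewrite (bigD1 i) //= mxE; have -> : (a i + i == mu i + s i)%N = false.
  apply/eqP; move: a_g => /=; have := ltn_ord i; have := ltn_ord (s i); lia.
by rewrite mul0r mulr0.
Qed.

Lemma content_fst (I J : finType) n (e : {ffun 'I_n -> I * J}) i :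
  content [ffun x => (e x).1] i = (\sum_j content e (i, j))%N.
Proof.
rewrite ffunE -sum1_card (partition_big (fun x => (e x).2) xpredT) //=.
apply: eq_bigr => j _; rewrite ffunE -sum1_card; apply: eq_bigl => x.
by rewrite !inE ffunE -pair_eqE.
Qed.

Lemma content_snd (I J : finType) n (e : {ffun 'I_n -> I * J}) j :
  content [ffun x => (e x).2] j = (\sum_i content e (i, j))%N.
Proof.
rewrite ffunE -sum1_card (partition_big (fun x => (e x).1) xpredT) //=.
apply: eq_bigr => i _; rewrite ffunE -sum1_card; apply: eq_bigl => x.
by rewrite !inE ffunE -pair_eqE andbC.
Qed.

Lemma big_pair_colorings (I J : finType) n (s : 'S_n)
    (G : {ffun 'I_n -> I} -> {ffun 'I_n -> J} -> algC) :
  \sum_(c | pfix s c) \sum_(d | pfix s d) G c d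
  = \sum_(e : {ffun 'I_n -> I * J} | pfix s e)
      G [ffun x => (e x).1] [ffun x => (e x).2].
Proof.
rewrite pair_big /=.
rewrite (reindex (fun e : {ffun 'I_n -> I * J} => ([ffun x => (e x).1], [ffun x => (e x).2]))) /=.
  apply: eq_bigl => e; apply/andP/pfixP => [[/pfixP e1 /pfixP e2] x|h].
    by have := e1 x; have := e2 x; rewrite !ffunE; case: (e _) (e _) => [??] [??] /= -> ->.
  by split; apply/pfixP=> x; rewrite !ffunE h.
exists (fun p : {ffun 'I_n -> I} * {ffun 'I_n -> J} => [ffun x => (p.1 x, p.2 x)]) => [e _|[c d] _] /=.
  by apply/ffunP=> x; rewrite !ffunE; case: (e x).
by congr pair; apply/ffunP=> x; rewrite !ffunE.
Qed.

(** A pair of invariant colourings is one colouring by pairs of colours, whose content is a matrix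
    with row sums [content c] and column sums b. Burnside counting replaces the colourings by these
    matrices, which [matrix_pieri] sums. Outside the rows, b is extended by 0. *)
Lemma alpha_pairing l n N (mu b : {ffun 'I_l -> nat}) (g : {ffun 'I_l -> 'I_N.+1}) :
  (forall i, g i = (mu i + rev_ord i)%N :> nat) -> (n <= N)%N ->
  (\sum_i b i)%N = n ->
  \sum_(s : 'S_n) alpha mu s * #|[set d | pfix s d && (content d == b)]|%:R
  = n`!%:R * pieri_coef (fun k => oapp b 0%N (insub k)) l g.
Proof.
move=> g_mu n_N b_n.
pose F (E : {ffun 'I_l * 'I_l -> nat}) : algC :=
  if [forall j, \sum_i E (i, j) == b j]%N then jt mu [ffun i => \sum_j E (i, j)]%N else 0.
transitivity (\sum_(s : 'S_n) \sum_(e : {ffun 'I_n -> 'I_l * 'I_l} | pfix s e) F (content e)).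
  apply: eq_bigr => s _.
  transitivity (\sum_(c : {ffun 'I_n -> 'I_l} | pfix s c)
      \sum_(d : {ffun 'I_n -> 'I_l} | pfix s d)
        (if content d == b then jt mu (content c) else 0)).
    rewrite mulr_suml; apply: eq_bigr => c _.
    by rewrite -big_mkcondr cardsE sumr_const mulr_natr.
  rewrite big_pair_colorings; apply: eq_bigr => e _; rewrite /F.
  have -> : (content [ffun x => (e x).2] == b) = [forall j, \sum_i content e (i, j) == b j]%N.
    apply/eqP/forallP => [<- j|h]; first by rewrite content_snd.
    by apply/ffunP=> j; rewrite content_snd (eqP (h j)).
  by case: ifP => // _; congr jt; apply/ffunP=> i; rewrite content_fst ffunE.
rewrite (orbit_sum _ n_N); congr (_ * _); rewrite -matrix_pieri.
rewrite (reindex (fun A : {ffun 'I_l -> {ffun 'I_l -> 'I_N.+1}} => [ffun p => A p.2 p.1])) /=; last first.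
  exists (fun a : {ffun 'I_l * 'I_l -> 'I_N.+1} => [ffun k => [ffun i => a (i, k)]]) => [A _|a _].
    by apply/ffunP=> k; apply/ffunP=> i; rewrite !ffunE.
  by apply/ffunP=> -[i k]; rewrite !ffunE.
rewrite big_mkcond [RHS]big_mkcond; apply: eq_bigr => A _; rewrite /F.
have colE : [forall j, \sum_i [ffun p => val ([ffun p => A p.2 p.1] p)] (i, j) == b j]%N
    = [forall k : 'I_l, \sum_i A k i == oapp b 0 (insub (val k))]%N.
  apply: eq_forallb => k; rewrite valK /=; congr (_ == _).
  by apply: eq_bigr => i _; rewrite !ffunE.
rewrite colE; case: (boolP [forall k, _]) => [/forallP A_b|_] /=; last by rewrite if_same.
have -> : (\sum_i [ffun p => A p.2 p.1] i == n)%N.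
  rewrite (eq_bigr (fun p => A p.2 p.1 : nat)) => [|p _]; last by rewrite ffunE.
  rewrite -(pair_bigA _ (fun i k => A k i : nat)) exchange_big /= -b_n.
  by apply/eqP/eq_bigr => k _; rewrite (eqP (A_b k)) valK.
set r := (X in jt mu X); have rowE i : r i = (\sum_k A k i)%N.
  by rewrite /r ffunE; apply: eq_bigr => k _; rewrite !ffunE.
clearbody r; rewrite (jt_alt0 _ g_mu).
have -> : [forall i, r i <= g i]%N = [forall i, \sum_k A k i <= g i]%N.
  by apply: eq_forallb => i; rewrite rowE.
by case: ifP => // _; congr alt0; apply/ffunP=> i; rewrite !ffunE rowE.
Qed.

(** Once w fixes everything below i, the partial sum up to i gives w i <= i, and injectivity
    excludes w i < i. *)
Lemma perm_dom1 l (w : 'S_l) :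
  (forall t, (t <= l)%N ->
     (\sum_(i < l | i < t) w i <= \sum_(i < l | i < t) i)%N) -> w = 1%g.
Proof.
move=> w_le; apply/permP=> i; rewrite perm1.
have [k] := ubnP (val i); elim: k i => // k IHk i /ltnSE i_k.
have w_lt (j : 'I_l) : (j < i)%N -> w j = j by move=> ji; apply: IHk; apply: leq_trans i_k.
apply: val_inj; apply/eqP; rewrite eqn_leq; apply/andP; split.
  have := w_le _ (ltn_ord i); rewrite (bigD1 i) //= [leqRHS](bigD1 i) //=.
  rewrite [X in (_ + X <= _)%N](eq_bigr (fun j : 'I_l => val j)) ?leq_add2r //.
  move=> j /andP[]; rewrite ltnS leq_eqVlt => /predU1P[/val_inj->|/w_lt->//].
  by rewrite eqxx.
rewrite leqNgt; apply/negP => wi; have := w_lt _ wi => /perm_inj w_eq.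
by move: wi; rewrite w_eq ltnn.
Qed.

(** Dominance of mu over b = mu + w - id says that the partial sums of w are at most those of the
    identity, which forces w = 1; there the Kostka number is 1. *)
Lemma alpha_pairing_weight l n (mu b : {ffun 'I_l -> nat}) (w : 'S_l) :
  (forall i j : 'I_l, (i <= j)%N -> (mu j <= mu i)%N) ->
  (\sum_i mu i)%N = n -> (forall i, b i + i = mu i + w i)%N ->
  \sum_(s : 'S_n) alpha mu s * #|[set d | pfix s d && (content d == b)]|%:R
  = n`!%:R * (w == 1%g)%:R.
Proof.
move=> mu_dec mu_n b_mu.
have b_n : (\sum_i b i)%N = n.
  have : (\sum_i (b i + i) = \sum_i (mu i + w i))%N by apply: eq_bigr => i _.
  rewrite !big_split /= mu_n [X in (_ = _ + X)%N -> _](_ : _ = \sum_(i < l) i)%N; first by move/addIn.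
  by rewrite [RHS](reindex_inj (@perm_inj _ w)).
pose N := (n + l)%N.
have mu_N (i : 'I_l) : (mu i + rev_ord i < N.+1)%N.
  rewrite ltnS leq_add //=; last exact: leq_subr.
  by rewrite -mu_n (bigD1 i) //= leq_addr.
pose g : {ffun 'I_l -> 'I_N.+1} := [ffun i => Ordinal (mu_N i)].
have g_mu (i : 'I_l) : g i = (mu i + rev_ord i)%N :> nat by rewrite ffunE.
have g_dec : strict_dec g.
  move=> i j ij; rewrite !g_mu /= -addnS leq_add ?mu_dec ?(ltnW ij) //.
  by apply: ltn_sub2l => //; apply: leq_ltn_trans ij (ltn_ord j).
rewrite (alpha_pairing g_mu (leq_addr _ _) b_n); congr (_ * _).
case: eqVneq => [w1|w_neq1].
  apply: pieri_coef_eq1 => // [i _|i]; last by have := ltn_ord i; lia.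
  by rewrite valK /= g_mu; have := b_mu i; rewrite w1 perm1 => /addIn->.
apply: contraNeq w_neq1 => /(pieri_coef_dominance g_dec (leqnn _))[_ _ dom].
apply/eqP/perm_dom1 => t t_l; have := dom t t_l.
have -> : (\sum_(k < t) oapp b 0%N (insub (val k)) = \sum_(i < l | i < t) b i)%N.
  rewrite (big_ord_widen l (fun k => oapp b 0%N (insub k))) //.
  by apply: eq_bigr => i _; rewrite valK.
rewrite [X in (_ <= X)%N -> _](eq_bigr (fun i : 'I_l => mu i + rev_ord i)%N) => [|i _]; last exact: g_mu.
rewrite big_split /= leq_add2r => b_le.
have : (\sum_(i < l | i < t) (b i + i) = \sum_(i < l | i < t) (mu i + w i))%N.
  by apply: eq_bigr => i _; apply: b_mu.
rewrite !big_split /=; move: b_le; lia.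
Qed.

(** * Irreducibility of the Jacobi-Trudi class functions *)

Lemma ind_stabc (I : finType) n (d : {ffun 'I_n -> I}) (s : 'S_n) :
  'Ind[Sgrp n] (1 : 'CF(stabc_Group d)) s
  = #|[set c | pfix s c && (content c == content d)]|%:R.
Proof.
rewrite cfIndE ?subsetT //.
pose f (y : 'S_n) := [ffun x => d (y x)].
have fE (y : 'S_n) : (1 : 'CF(stabc_Group d)) (s ^ y)%g = (pfix s (f y))%:R.
  rewrite cfun1E inE /=; congr (nat_of_bool _)%:R; apply/pfixP/pfixP => h x.
    by have := h (y x); rewrite !ffunE conjgE !permM permK.
  by have := h (y^-1 x)%g; rewrite !ffunE conjgE !permM permKV.
under eq_bigr do rewrite fE.
rewrite (partition_big f (fun c => content c == content d)) /=; last first.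
  by move=> y _; apply/eqP/(@content_pfix _ _ _ _ y) => x; rewrite ffunE.
transitivity (#|stabc d|%:R^-1 *
  \sum_(c | content c == content d) (pfix s c)%:R * #|stabc d|%:R : algC).
  congr (_ * _); apply: eq_bigr => c /eqP cd; have [c_tr <-] := card_transport cd.
  rewrite -c_tr -sum1_card natr_sum mulr_sumr.
  rewrite [RHS](eq_bigl (fun y => (y \in Sgrp n) && (f y == c))).
    by apply: eq_bigr => y /andP[_ /eqP->]; rewrite mulr1.
  move=> y; rewrite !inE eq_sym.
  apply/forallP/eqP => [h|/ffunP h x]; last by rewrite h ffunE.
  by apply/ffunP => x; rewrite ffunE (eqP (h x)).
rewrite -mulr_suml mulrCA mulVf ?mulr1; last first.
  by rewrite pnatr_eq0 -lt0n (cardD1 1%g) group1.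
rewrite -sum1_card natr_sum big_mkcond [RHS]big_mkcond.
by apply: eq_bigr => c _; rewrite inE; case: pfix; case: eqP.
Qed.

(** The value 0 is taken when b does not sum to n; [MchE] then holds too, as no colouring has
    content b. *)
Definition Mch l n (b : {ffun 'I_l -> nat}) : 'CF(Sgrp n) :=
  if [pick c : {ffun 'I_n -> 'I_l} | content c == b] is Some c
  then 'Ind[Sgrp n] (1 : 'CF(stabc_Group c)) else 0.

Lemma MchE l n (b : {ffun 'I_l -> nat}) (s : 'S_n) :
  Mch n b s = #|[set c | pfix s c && (content c == b)]|%:R.
Proof.
rewrite /Mch; case: pickP => [c /eqP <-|no_c]; first exact: ind_stabc.
by rewrite cfunE eq_card0 // => c; rewrite !inE no_c andbF.
Qed.

Lemma Mch_char l n (b : {ffun 'I_l -> nat}) : Mch n b \is a character.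
Proof.
rewrite /Mch; case: pickP => [c _|_]; last exact: rpred0.
by apply: cfInd_char; apply: cfun1_char.
Qed.

(** These w make the truncated subtraction in [jt_weight] exact; for the others the term of the
    Jacobi-Trudi determinant vanishes. *)
Definition jt_valid l (mu : {ffun 'I_l -> nat}) (w : 'S_l) : bool :=
  [forall i : 'I_l, i <= mu i + w i]%N.

Definition jt_weight l (mu : {ffun 'I_l -> nat}) (w : 'S_l) : {ffun 'I_l -> nat} :=
  [ffun i => (mu i + w i - i)%N].

Lemma jt_weight1 l (mu : {ffun 'I_l -> nat}) : jt_weight mu 1 = mu.
Proof. by apply/ffunP=> i; rewrite ffunE perm1 addnK. Qed.

Lemma jt_valid1 l (mu : {ffun 'I_l -> nat}) : jt_valid mu 1.
Proof. by apply/forallP=> i; rewrite perm1 leq_addl. Qed.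

Lemma jtE l (mu a : {ffun 'I_l -> nat}) :
  jt mu a = \sum_(w : 'S_l | jt_valid mu w) (-1) ^+ w * (a == jt_weight mu w)%:R.
Proof.
rewrite [RHS]big_mkcond; apply: eq_bigr => w _.
have -> : \prod_i (\matrix_(i, j) (a i + i == mu i + j)%N%:R) i (w i)
   = [forall i, a i + i == mu i + w i]%N%:R :> algC.
  have [/forallP h|/forallPn[i /negPf h]] := boolP [forall i, a i + i == mu i + w i]%N.
    by rewrite big1 // => i _; rewrite mxE h.
  by rewrite (bigD1 i) //= mxE h mul0r.
have -> : [forall i, a i + i == mu i + w i]%N = jt_valid mu w && (a == jt_weight mu w).
  apply/forallP/andP => [h|[/forallP w_ok /eqP-> i]].
    split; last by apply/eqP/ffunP => i; rewrite ffunE -(eqP (h i)) addnK.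
    by apply/forallP=> i; rewrite -(eqP (h i)) leq_addl.
  by rewrite ffunE subnK.
by case: jt_valid; rewrite ?mulr0.
Qed.

Definition alphaCF l n (mu : {ffun 'I_l -> nat}) : 'CF(Sgrp n) :=
  \sum_(w : 'S_l | jt_valid mu w) (-1) ^+ w *: Mch n (jt_weight mu w).

Lemma alphaCFE l n (mu : {ffun 'I_l -> nat}) (s : 'S_n) :
  alphaCF n mu s = alpha mu s.
Proof.
rewrite sum_cfunE /alpha; under [RHS]eq_bigr do rewrite jtE.
rewrite exchange_big /=; apply: eq_bigr => w _; rewrite cfunE MchE -mulr_sumr.
congr (_ * _); rewrite -sum1_card natr_sum big_mkcond [RHS]big_mkcond.
by apply: eq_bigr => c _; rewrite inE; case: pfix; case: eqP.
Qed.

Section AlphaIrr.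
Variables (l n : nat) (mu : {ffun 'I_l -> nat}).
Hypothesis mu_dec : forall i j : 'I_l, (i <= j)%N -> (mu j <= mu i)%N.
Hypothesis mu_n : (\sum_i mu i)%N = n.

Lemma alphaCF_Mch (w : 'S_l) : jt_valid mu w ->
  '[alphaCF n mu, Mch n (jt_weight mu w)] = (w == 1%g)%:R.
Proof.
move=> /forallP w_ok; rewrite cfdotE.
have b_mu i : (jt_weight mu w i + i = mu i + w i)%N by rewrite ffunE subnK.
under eq_bigr do rewrite alphaCFE MchE rmorph_nat.
rewrite (eq_bigl xpredT) => [|s]; last by rewrite inE.
rewrite (alpha_pairing_weight mu_dec mu_n b_mu) cardsT card_Sn mulKf //.
by rewrite pnatr_eq0 -lt0n fact_gt0.
Qed.

Lemma alphaCF_irr : exists i, alphaCF n mu = 'chi_i.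
Proof.
have Z_alpha : alphaCF n mu \in 'Z[irr (Sgrp n)]%g.
  by apply: rpred_sum => w _; rewrite rpredZsign char_vchar ?Mch_char.
have norm1 : '[alphaCF n mu] = 1.
  rewrite {2}/alphaCF cfdot_sumr (bigD1 1%g) ?jt_valid1 //=.
  rewrite cfdotZr alphaCF_Mch ?jt_valid1 // eqxx odd_perm1 expr0 rmorph1 mulr1.
  rewrite big1 ?addr0 // => w /andP[w_ok /negPf w1].
  by rewrite cfdotZr alphaCF_Mch // w1 mulr0.
have [[] [i alpha_i]] := vchar_norm1P Z_alpha norm1; last first.
  by exists i; rewrite alpha_i scale1r.
(* In the remaining case alpha is -'chi_i, whose pairing with M^mu is 1; this would give 'chi_i the
   multiplicity -1 in a character. *)
have := alphaCF_Mch (jt_valid1 mu); rewrite jt_weight1 eqxx alpha_i cfdotZl.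
rewrite mulN1r => /eqP; rewrite eqr_oppLR => /eqP mult.
have : 0 <= '['chi_i, Mch n mu] by apply: natr_ge0; rewrite Cnat_cfdot_char ?irr_char ?Mch_char.
by rewrite mult oppr_ge0 ler10.
Qed.

End AlphaIrr.

(** * Submodules of the regular representation *)

(** In a rank factorisation E = c r, idempotency forces r c = 1, and the trace is cyclic. *)
Lemma mxtrace_idem (F : numFieldType) n (E : 'M[F]_n) :
  E *m E = E -> \tr E = (\rank E)%:R.
Proof.
have := mulmx_base E; have /row_freeP[X] := row_base_free E.
have /row_fullP[Z] := col_base_full E.
move: (col_base E) (row_base E) => c r ZE XE E_cr EE.
suff rc : r *m c = 1%:M by rewrite -{1}E_cr mxtrace_mulC rc mxtrace1.
move: EE; rewrite -{1 2 3}E_cr; move/(congr1 (fun M => Z *m M *m X)).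
by rewrite /= !mulmxA ZE mul1mx -!mulmxA XE !mulmx1.
Qed.

Lemma mxtrace_submod (F : fieldType) (gT : finGroupType) (G : {group gT}) n
    (rG : mx_representation F G n) (U E : 'M_n) (Umod : mxmodule rG U) g :
  g \in G -> E *m rG g = rG g *m E -> (E <= U)%MS -> U *m E = U ->
  \tr (submod_repr Umod g) = \tr (E *m rG g).
Proof.
move=> Gg EgC E_U UE; pose v := val_submod (1%:M : 'M_(\rank U)).
have vE : v *m E = v.
  by have /submxP[D vD] : (v <= U)%MS := val_submodP _; rewrite vD -mulmxA UE.
rewrite -[LHS]/(\tr (in_submod U (v *m rG g))) in_submodE.
have : E *m in_submod U 1%:M *m v = E by rewrite -in_submodE -val_submodE in_submodK.
move: (in_submod U 1%:M) v vE => I v vE EIv.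
rewrite mxtrace_mulC -{1}vE -[v *m E *m _]mulmxA EgC mulmxA mulmxA mxtrace_mulC.
by rewrite !mulmxA EIv EgC.
Qed.

Section RegularSubmodule.

Variables (gT : finGroupType) (G : {group gT}).
Local Notation nG := #|G|.
Local Notation aG := (regular_repr algC G).

Lemma regular_reprE (v : 'rV[algC]_nG) x i :
  x \in G -> (v *m aG x) 0 i = v 0 (gring_index G (enum_val i * x^-1)%g).
Proof.
move=> Gx; rewrite mxE (bigD1 (gring_index G (enum_val i * x^-1)%g)) //= !mxE /=.
rewrite gring_indexK ?groupM ?groupV ?enum_valP // mulgKV gring_valK !eqxx mulr1.
rewrite big1 ?addr0 // => j j_neq; rewrite !mxE /=.
case: eqP => [i_eq|_]; last by rewrite mulr0.
case/eqP: j_neq; rewrite i_eq gring_indexK ?groupM ?enum_valP //.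
by rewrite mulgK gring_valK.
Qed.

Lemma gring_mxE n (rG : mx_representation algC G n) (f : 'rV[algC]_nG) :
  gring_mx rG f = \sum_(x in G) f 0 (gring_index G x) *: rG x.
Proof.
rewrite /gring_mx /= mulmx_sum_row linear_sum [RHS]big_enum_val /=.
apply: eq_bigr => i _; rewrite linearZ /= rowK mxvecK gring_valK.
by [].
Qed.

(** By Maschke, U is the image of an equivariant projection E, and E is determined by its row f at
    the identity, an idempotent of the group algebra lying in U. For irreducible [rG] the scalar
    product is the multiplicity, here obtained as a trace of f. *)
Lemma regular_submod_idem (U : 'M_nG) (Umod : mxmodule aG U) :
  exists2 f : 'rV_nG, (f <= U)%MS
    & forall n (rG : mx_representation algC G n),
        gring_mx rG f *m gring_mx rG f = gring_mx rG f
        /\ '[cfRepr (submod_repr Umod), cfRepr rG] = \tr (gring_mx rG f).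
Proof.
have [W Wmod UW dxUW] := mx_Maschke_pchar aG (algC'G_pchar G) Umod (submx1 U).
have dUW : (U :&: W = 0)%MS by apply/mxdirect_addsP.
pose E := proj_mx U W.
have E_U : (E <= U)%MS by rewrite -[E]mul1mx proj_mx_sub.
have UE : U *m E = U by apply: proj_mx_id.
have homE : ((1%:M : 'M_nG) <= dom_hom_mx aG E)%MS.
  by apply: submx_trans (proj_mx_hom dUW Umod Wmod); rewrite UW.
have EC g : g \in G -> E *m aG g = aG g *m E.
  by move=> Gg; have /hom_mxP/(_ g Gg) := homE; rewrite !mul1mx.
pose f := gring_row E.
have fE : (f <= U)%MS by rewrite (submx_trans (row_sub _ _)).
have f_mul (v : 'rV_nG) : v *m E = f *m gring_mx aG v.
  have := hom_envelop_mxC homE (gring_mxP aG v); rewrite !mul1mx => EM.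
  by rewrite -gring_row_mul -EM gring_row_mul gring_mxK.
exists f => // n rG; split.
  rewrite -gring_mxA -f_mul; have /submxP[D ->] := fE.
  by rewrite -mulmxA UE.
rewrite cfdotE.
have chE g : g \in G -> cfRepr (submod_repr Umod) g
    = \sum_(x in G) f 0 (gring_index G (x * g^-1 * x^-1)%g).
  move=> Gg; rewrite cfunE Gg mulr1n (mxtrace_submod _ Gg (EC g Gg) E_U UE).
  rewrite /mxtrace [RHS]big_enum_val; apply: eq_bigr => i _.
  have rowE : row i E = f *m aG (enum_val i).
    rewrite /f -gring_row_mul EC ?enum_valP // gring_row_mul.
    by rewrite /gring_row rowK gring_indexK // mul1g gring_valK -rowE.
  have -> : (E *m aG g) i i = (row i E *m aG g) 0 i by rewrite -row_mul [RHS]mxE.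
  rewrite rowE regular_reprE // regular_reprE ?enum_valP //.
  by rewrite gring_indexK ?groupM ?groupV ?enum_valP.
rewrite gring_mxE (raddf_sum (@mxtrace _ n)) /=.
transitivity (#|G|%:R^-1 * \sum_(x in G) \sum_(y in G)
   f 0 (gring_index G y) * cfRepr rG y).
  congr (_ * _); under eq_bigr => g Gg do rewrite chE // mulr_suml.
  rewrite exchange_big /=; apply: eq_bigr => x Gx.
  (* The substitution turns the argument of f into y, while the conjugate character at the inverse
     of y ^ x is the character at y. *)
  rewrite (reindex_inj (h := fun y => (y ^ x)^-1%g)) /=; last first.
    by move=> y z /invg_inj/conjg_inj.
  apply: eq_big => [y|y Gy]; first by rewrite groupV memJ_norm // (subsetP (normG G)).
  rewrite -char_inv ?cfRepr_char // invgK cfunJgen ?genGid //.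
  congr (f 0 (gring_index G _) * _).
  by rewrite conjgE !mulgA mulgV mul1g mulgK.
rewrite sumr_const -[X in _ * X]mulr_natl mulKf; last by rewrite pnatr_eq0 -lt0n cardG_gt0.
by apply: eq_bigr => y Gy; rewrite mxtraceZ cfunE Gy mulr1n.
Qed.

(* The multiplicity is the rank of the idempotent of regular_submod_idem,
   which lies in the right ideal generated by A * B. *)
Lemma cyclic_product_mult (A B : 'M[algC]_nG) u j :
  u = gring_row (A *m B) ->
  (A \in enveloping_algebra_mx aG)%MS -> (B \in enveloping_algebra_mx aG)%MS ->
  exists k : nat,
    [/\ '[cfRepr (submod_repr (cyclic_mx_module aG u)), 'chi_j] = k%:R,
        (k <= \rank (gring_op 'Chi_j A))%N & (k <= \rank (gring_op 'Chi_j B))%N].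
Proof.
move=> u_AB RA RB; have [f fU /(_ _ 'Chi_j)[fI f_mult]] :=
  regular_submod_idem (cyclic_mx_module aG u).
exists (\rank (gring_mx 'Chi_j f)); rewrite -irrRepr f_mult mxtrace_idem //.
have [D RD fD] := cyclic_mxP fU.
have -> : gring_mx 'Chi_j f = gring_op 'Chi_j A *m gring_op 'Chi_j B *m gring_op 'Chi_j D.
  by rewrite fD u_AB -gring_row_mul -gring_opE !gring_opM.
split=> //; first by rewrite -mulmxA mxrankM_maxl.
by apply: leq_trans (mxrankM_maxl _ _) (mxrankM_maxr _ _).
Qed.

Lemma twisted_sum_mxM (eps : gT -> algC) n (rG : mx_representation algC G n)
    (H : {group gT}) (X := \sum_(h in H) eps h *: rG h) :
  H \subset G -> {in H &, {morph eps : x y / (x * y)%g >-> x * y}} ->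
  X *m X = #|H|%:R *: X.
Proof.
move=> sHG epsM; rewrite {1}/X mulmx_suml scaler_nat -sumr_const.
apply: eq_bigr => h Hh; rewrite /X mulmx_sumr.
rewrite [RHS](reindex_inj (mulgI h)) /=.
apply: eq_big => [k|k Hk]; first by rewrite groupMl.
by rewrite -scalemxAl -scalemxAr scalerA repr_mxM ?(subsetP sHG) // epsM.
Qed.

(** Divided by |H| the sum is idempotent, so its rank is its trace. For eps trivial or the sign,
    this is the multiplicity of 'chi_j in the character induced from eps on H. *)
Lemma twisted_sum_rank (eps : gT -> algC) (j : Iirr G) (H : {group gT}) :
  H \subset G -> {in H &, {morph eps : x y / (x * y)%g >-> x * y}} ->
  (\rank (\sum_(h in H) eps h *: 'Chi_j h)%R)%:R
  = #|H|%:R^-1 * \sum_(h in H) eps h * 'chi_j h.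
Proof.
move=> sHG epsM; set X := (X in \rank X).
have XX : X *m X = #|H|%:R *: X := twisted_sum_mxM 'Chi_j sHG epsM.
have H0 : #|H|%:R != 0 :> algC by rewrite pnatr_eq0 -lt0n cardG_gt0.
have HV0 : #|H|%:R^-1 != 0 :> algC by rewrite invr_eq0.
have EE : (#|H|%:R^-1 *: X) *m (#|H|%:R^-1 *: X) = #|H|%:R^-1 *: X.
  by rewrite -scalemxAl -scalemxAr XX !scalerA -mulrA mulVf // mulr1.
rewrite -(mxrank_scale_nz X HV0) -(mxtrace_idem EE) mxtraceZ; congr (_ * _).
rewrite /X (raddf_sum (@mxtrace _ _)) /=; apply: eq_bigr => h Hh.
by rewrite mxtraceZ -irrRepr cfunE (subsetP sHG) // mulr1n.
Qed.

End RegularSubmodule.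

(** * Specht modules *)

Definition part_fun l (mu : seq nat) : {ffun 'I_l -> nat} := [ffun i => nth 0%N mu (val i)].

Lemma sorted_nth_dec (mu : seq nat) i j :
  sorted geq mu -> (i <= j)%N -> (nth 0 mu j <= nth 0 mu i)%N.
Proof.
move=> mu_sorted ij; have [j_sz|?] := ltnP j (size mu); last by rewrite nth_default.
have geq_trans : transitive geq by move=> ? ? ? /[swap]; apply: leq_trans.
by apply: (sorted_leq_nth geq_trans leqnn 0%N mu_sorted); rewrite ?inE //; apply: leq_ltn_trans j_sz.
Qed.

Lemma part_sorted (mu : seq nat) : is_part mu -> sorted geq mu.
Proof. by case/andP. Qed.

Lemma sum_content_pred (I : finType) n (c : {ffun 'I_n -> I}) (P : pred I) :
  (\sum_(i | P i) content c i)%N = #|[set x | P (c x)]|.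
Proof.
rewrite -sum1_card (partition_big c P) /=; last by move=> x; rewrite inE.
apply: eq_bigr => i Pi; rewrite ffunE -sum1_card; apply: eq_bigl => x.
by rewrite !inE; case: eqP => [->|_]; rewrite ?Pi ?andbF.
Qed.

Section YoungTableau.

Variables (mu : seq nat) (l : nat).
Hypotheses (mu_part : is_part mu) (mu_l : (size mu <= l)%N).
Local Notation n := (sumn mu).

Definition row_coloring : {ffun 'I_n -> 'I_l} :=
  [ffun x : 'I_n => Ordinal (leq_trans (reshape_indexP (ltn_ord x)) mu_l)].

Lemma offset_ltn (x : 'I_n) : (reshape_offset mu x < n.+1)%N.
Proof. by rewrite ltnS (leq_trans (leq_subr _ _)) // ltnW. Qed.

Definition col_coloring : {ffun 'I_n -> 'I_n.+1} :=
  [ffun x => Ordinal (offset_ltn x)].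

Lemma row_stabE : row_stab mu = stabc row_coloring.
Proof.
apply/setP=> s; rewrite !inE; apply: eq_forallb => x.
by rewrite !ffunE -val_eqE.
Qed.

Lemma col_stabE : col_stab mu = stabc col_coloring.
Proof.
apply/setP=> s; rewrite !inE; apply: eq_forallb => x.
by rewrite !ffunE -val_eqE.
Qed.

Lemma content_row : content row_coloring = part_fun l mu.
Proof.
apply/ffunP=> i; rewrite !ffunE.
pose f (k : 'I_(nth 0%N mu i)) : 'I_n := Ordinal (flatten_indexP (ltn_ord k)).
have f_inj : injective f.
  move=> j k /(congr1 (fun x : 'I_n => reshape_offset mu x)) /=.
  by rewrite !flatten_indexKr // => /val_inj.
rewrite -[RHS]card_ord -cardsT -(card_imset _ f_inj); apply: eq_card => x.
rewrite inE ffunE -val_eqE /=; apply/eqP/imsetP => [xi|[k _ ->]]; last first.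
  by rewrite /= flatten_indexKl.
have x_lt := reshape_offsetP (ltn_ord x); rewrite xi in x_lt.
exists (Ordinal x_lt); rewrite // -[x in LHS]/(x); apply: val_inj.
by rewrite /= -xi reshape_indexK.
Qed.

Definition colinj (d : {ffun 'I_n -> 'I_n.+1}) (c : {ffun 'I_n -> 'I_l}) : bool :=
  [forall x, forall y, (d x == d y) && (c x == c y) ==> (x == y)].

Lemma colinjP (d : {ffun 'I_n -> 'I_n.+1}) (c : {ffun 'I_n -> 'I_l}) :
  reflect (forall x y, d x = d y -> c x = c y -> x = y) (colinj d c).
Proof.
apply: (iffP forallP) => [h x y dxy cxy|h x].
  by have /forallP/(_ y) := h x; rewrite dxy cxy !eqxx => /eqP.
by apply/forallP=> y; apply/implyP=> /andP[/eqP dxy /eqP cxy]; apply/eqP/h.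
Qed.

(** If c repeats a colour within a class of d, the transposition of the two cells preserves both c
    and d and reverses the sign; otherwise only the identity preserves both. *)
Lemma sum_col_stab (d : {ffun 'I_n -> 'I_n.+1}) (F : {ffun 'I_l -> nat} -> algC) :
  \sum_(q in stabc d) (-1) ^+ (q : bool) * \sum_(c : {ffun 'I_n -> 'I_l} | pfix q c) F (content c)
  = \sum_(c | colinj d c) F (content c).
Proof.
rewrite (sum_perm_colorings [in stabc d] (fun q => (-1) ^+ (q : bool))).
rewrite [RHS]big_mkcond; apply: eq_bigr => c _.
case: ifP => [/colinjP c_inj|/negbT c_ninj].
  rewrite (big_pred1 1%g) => [|s]; first by rewrite odd_perm1 mul1r.
  rewrite !inE; apply/andP/eqP => [[/pfixP cs /pfixP ds]|->].
    by apply/permP=> x; rewrite perm1; apply: c_inj.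
  by split; apply/pfixP=> x; rewrite perm1.
have [x [y [dxy cxy xy]]] : exists x y, [/\ d x = d y, c x = c y & x != y].
  move: c_ninj; rewrite negb_forall => /existsP[x]; rewrite negb_forall => /existsP[y].
  by rewrite negb_imply => /andP[/andP[/eqP ? /eqP ?] ?]; exists x, y.
have fixt (I : finType) (a : {ffun 'I_n -> I}) s : a x = a y ->
    pfix (tperm x y * s)%g a = pfix s a.
  move=> axy; have at_fix z : a (tperm x y z) = a z by case: tpermP => [->|->|].
  apply/pfixP/pfixP => h z; last by rewrite permM h at_fix.
  by have := h (tperm x y z); rewrite permM tpermK at_fix.
rewrite [X in X * _](_ : _ = 0) ?mul0r //; apply: eq_oppr0.
rewrite [LHS](reindex_inj (mulgI (tperm x y))) -sumrN /=.
apply: eq_big => [s|s _]; first by rewrite !inE !fixt.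
by rewrite odd_mul_tperm xy signr_addb mulN1r.
Qed.

(* In each column, c uses every colour below t at most once, and the column
   either lies in the first t rows or contains a cell of each of them. *)
Lemma colinj_dominance (c : {ffun 'I_n -> 'I_l}) t : colinj col_coloring c ->
  (\sum_(i < l | i < t) content c i <= \sum_(i < l | i < t) part_fun l mu i)%N.
Proof.
move=> /colinjP c_inj; rewrite -content_row !sum_content_pred.
rewrite -!sum1_card (partition_big col_coloring xpredT) //=.
rewrite [leqRHS](partition_big col_coloring xpredT) //=.
apply: leq_sum => k _; rewrite !sum1dep_card.
have [/existsP[x0 /andP[/eqP x0k t_x0]]|/existsPn col_low] :=
  boolP [exists x, (col_coloring x == k) && (t <= row_coloring x)%N]; last first.
  apply: subset_leq_card; apply/subsetP=> x; rewrite !inE => /andP[_ xk].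
  by have := col_low x; rewrite xk /= -ltnNge => ->.
have k_lt i : (i < t)%N -> (k < nth 0 mu i)%N.
  move=> it; rewrite -x0k ffunE; apply: leq_trans (reshape_offsetP (ltn_ord x0)) _.
  by apply: sorted_nth_dec (part_sorted mu_part) _; apply: leq_trans (ltnW it) _; move: t_x0; rewrite ffunE.
have k_n i : (i < t)%N -> (flatten_index mu i k < n)%N by move=> /k_lt/flatten_indexP.
pose h (i : 'I_l) : 'I_n := insubd x0 (flatten_index mu i k).
have hE (i : 'I_l) : (i < t)%N -> h i = flatten_index mu i k :> nat.
  by move=> it; rewrite val_insubd k_n.
apply: (@leq_trans #|[set i : 'I_l | (i < t)%N]|).
  rewrite -(card_in_imset (f := c)).
    apply: subset_leq_card; apply/subsetP=> _ /imsetP[x xP ->].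
    by move: xP; rewrite !inE => /andP[].
  move=> x y; rewrite !inE => /andP[_ /eqP xk] /andP[_ /eqP yk].
  by apply: c_inj; rewrite xk yk.
rewrite -(card_in_imset (f := h)).
  apply: subset_leq_card; apply/subsetP=> _ /imsetP[i it ->]; rewrite inE in it.
  by rewrite !inE !ffunE -!val_eqE /= hE // flatten_indexKl ?flatten_indexKr ?it /= ?eqxx ?k_lt.
move=> i j; rewrite !inE => it jt /(congr1 (fun x : 'I_n => reshape_index mu x)).
by rewrite /= !hE // !flatten_indexKl ?k_lt // => /val_inj.
Qed.

End YoungTableau.

Section SpechtCharacter.

Variables (mu : seq nat) (l : nat).
Hypotheses (mu_part : is_part mu) (mu_l : (size mu <= l)%N).
Local Notation n := (sumn mu).
Local Notation G := (Sgrp n).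
Local Notation aG := (regular_repr algC G).
Local Notation d_row := (row_coloring mu_l).
Local Notation d_col := (col_coloring mu).
Local Notation muf := (part_fun l mu).

Lemma sum_part_fun : (\sum_i muf i)%N = n.
Proof.
rewrite sumnE (big_nth 0%N) big_mkord (big_ord_widen l (nth 0%N mu)) // [RHS]big_mkcond.
apply: eq_bigr => i _; rewrite ffunE; case: ltnP => // ?; exact: nth_default.
Qed.

Lemma part_fun_dec (i j : 'I_l) : (i <= j)%N -> (muf j <= muf i)%N.
Proof. by move=> ij; rewrite !ffunE sorted_nth_dec // part_sorted. Qed.

(** The multiplicities of 'chi_j in M^mu and in the sign character induced from the column group. As
    ranks they bound the multiplicity in the Specht module. *)
Definition row_rank (j : Iirr G) : nat :=
  \rank (\sum_(p in stabc_Group d_row) 1 *: 'Chi_j p)%R.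
Definition col_rank (j : Iirr G) : nat :=
  \rank (\sum_(q in stabc_Group d_col) (-1) ^+ (q : bool) *: 'Chi_j q)%R.

Lemma row_rankE j :
  (row_rank j)%:R = #|stabc d_row|%:R^-1 * \sum_(p in stabc d_row) 'chi_j p.
Proof.
rewrite (@twisted_sum_rank _ G (fun=> 1)) ?subsetT //; last by move=> ? ? _ _; rewrite mulr1.
by congr (_ * _); apply: eq_bigr => p _; rewrite mul1r.
Qed.

Lemma col_rankE j :
  (col_rank j)%:R
  = #|stabc d_col|%:R^-1 * \sum_(q in stabc d_col) (-1) ^+ (q : bool) * 'chi_j q.
Proof.
rewrite (@twisted_sum_rank _ G (fun q : 'S_n => (-1) ^+ (q : bool))) ?subsetT //.
by move=> p q _ _; rewrite odd_permM signr_addb.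
Qed.

Lemma Mch_row : Mch n muf = 'Ind[G] (1 : 'CF(stabc_Group d_row)).
Proof. by apply/cfunP => s; rewrite MchE ind_stabc content_row. Qed.

Lemma cfdot_Mch_row j : '['chi_j, Mch n muf] = (row_rank j)%:R.
Proof.
rewrite Mch_row -cfdot_Res_l cfdotE row_rankE; congr (_ * _).
apply: eq_bigr => p Rp.
by rewrite cfResE ?subsetT // cfun1E Rp conjC1 mulr1.
Qed.

(** Only colourings injective on columns survive, and mu dominates their contents; among the weights
    of the determinant expansion, only that of w = 1 is compatible with this. *)
Lemma col_sum_alpha :
  \sum_(q in stabc d_col) (-1) ^+ (q : bool) * alphaCF n muf q
  = \sum_(q in stabc d_col) (-1) ^+ (q : bool) * Mch n muf q.
Proof.
under eq_bigr do rewrite alphaCFE; rewrite /alpha sum_col_stab.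
transitivity (\sum_(q in stabc d_col) (-1) ^+ (q : bool) *
  \sum_(c : {ffun 'I_n -> 'I_l} | pfix q c) (content c == muf)%:R : algC); last first.
  apply: eq_bigr => q _; congr (_ * _); rewrite MchE -sum1_card natr_sum.
  rewrite big_mkcond [RHS]big_mkcond; apply: eq_bigr => c _; rewrite inE.
  by case: pfix; case: eqP.
rewrite (sum_col_stab d_col (fun a => (a == muf)%:R)); apply: eq_bigr => c c_inj.
rewrite jtE (bigD1 1%g) ?jt_valid1 //= odd_perm1 mul1r jt_weight1 big1 ?addr0 //.
move=> w /andP[/forallP w_ok w_neq1]; case: eqP => [cw|_]; last by rewrite mulr0.
case/eqP: w_neq1; apply: perm_dom1 => t _.
have := colinj_dominance mu_part mu_l t c_inj; rewrite cw => mu_le.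
have : (\sum_(i < l | i < t) (jt_weight muf w i + i)
        = \sum_(i < l | i < t) (muf i + w i))%N.
  by apply: eq_bigr => i _; rewrite [jt_weight _ _ _]ffunE subnK.
rewrite !big_split /= => e_sum.
by rewrite -(leq_add2l (\sum_(i < l | i < t) muf i)%N) -e_sum leq_add2r.
Qed.

(** Decomposing M^mu into irreducibles in [col_sum_alpha] gives s_i = sum_j r_j s_j for the row
    ranks r and column ranks s. As r_i = 1 and all terms are nonnegative, those with j != i
    vanish. *)
Lemma row_col_rank i : alphaCF n muf = 'chi_i ->
  row_rank i = 1%N /\ forall j, j != i -> (row_rank j * col_rank j = 0)%N.
Proof.
move=> alpha_i; have r_i : row_rank i = 1%N.
  apply/eqP; rewrite -(eqr_nat algC) -cfdot_Mch_row -alpha_i.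
  have := alphaCF_Mch part_fun_dec sum_part_fun (jt_valid1 muf).
  by rewrite jt_weight1 eqxx => ->.
split=> // j j_neq.
have s_i : (col_rank i = \sum_j row_rank j * col_rank j)%N.
  apply/eqP; rewrite -(eqr_nat algC) col_rankE -alpha_i col_sum_alpha natr_sum.
  have M_sum q : Mch n muf q = \sum_j (row_rank j)%:R * 'chi_j q.
    rewrite [Mch n muf]cfun_sum_cfdot sum_cfunE; apply: eq_bigr => k _.
    by rewrite cfunE cfdotC cfdot_Mch_row rmorph_nat.
  have -> : \sum_(q in stabc d_col) (-1) ^+ (q : bool) * Mch n muf q
    = \sum_k (row_rank k)%:R * \sum_(q in stabc d_col) (-1) ^+ (q : bool) * 'chi_k q.
    under eq_bigr => q _ do rewrite M_sum mulr_sumr.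
    rewrite exchange_big; apply: eq_bigr => k _; rewrite mulr_sumr.
    by apply: eq_bigr => q _; rewrite mulrCA.
  rewrite mulr_sumr; apply/eqP/eq_bigr => k _.
  by rewrite natrM col_rankE mulrCA.
move: s_i; rewrite (bigD1 i) //= r_i mul1n -{1}[col_rank i]addn0 => /addnI/esym/eqP.
by rewrite sum_nat_eq0 => /forallP/(_ j); rewrite j_neq /= => /eqP.
Qed.

Definition row_sum_mx : 'M[algC]_#|G| := \sum_(p in stabc d_row) aG p.
Definition col_sum_mx : 'M[algC]_#|G| :=
  \sum_(q in stabc d_col) (-1) ^+ (q : bool) *: aG q.

Lemma young_symmetrizerE : young_symmetrizer mu = gring_row (row_sum_mx *m col_sum_mx).
Proof.
rewrite /young_symmetrizer (row_stabE mu_l) col_stabE /row_sum_mx /col_sum_mx.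
rewrite mulmx_suml linear_sum; apply: eq_bigr => p _.
rewrite mulmx_sumr linear_sum; apply: eq_bigr => q _.
rewrite -scalemxAr linearZ -repr_mxM ?inE //=; congr (_ *: _).
by rewrite /gring_row rowK gring_indexK // mul1g.
Qed.

(** The coefficient at the identity is 1: if p q = 1 with p preserving rows and q preserving
    columns, then p fixes every cell. *)
Lemma young_symmetrizer_neq0 : young_symmetrizer mu != 0.
Proof.
apply/eqP=> /rowP/(_ (gring_index G 1)); rewrite mxE summxE.
have idxE (s : 'S_n) : (gring_index G 1%g == gring_index G s) = (s == 1%g).
  apply/eqP/eqP => [/(congr1 enum_val)|->//].
  by rewrite !gring_indexK ?inE // => <-.
rewrite (bigD1 1%g) /=; last by rewrite inE; apply/forallP=> x; rewrite perm1.
rewrite summxE (bigD1 1%g) /=; last by rewrite inE; apply/forallP=> x; rewrite perm1.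
rewrite !mxE eqxx mulg1 idxE eqxx odd_perm1 mulr1 !big1 ?addr0.
- by move/eqP; rewrite oner_eq0.
- move=> p /andP[]; rewrite inE => /forallP p_row p_neq1; rewrite summxE big1 // => q.
  rewrite inE => /forallP q_col; rewrite !mxE idxE eqxx; case: eqP => [pq1|_]; last by rewrite mulr0.
  case/eqP: p_neq1; apply/permP => x; rewrite perm1; apply: val_inj.
  rewrite /= -(reshape_indexK mu (p x)) -[RHS](reshape_indexK mu x) (eqP (p_row x)).
  congr flatten_index; rewrite -(eqP (q_col (p x))).
  by have /permP/(_ x) := pq1; rewrite permM perm1 => ->.
- move=> q /andP[_ /negPf q_neq1]; rewrite !mxE mul1g idxE q_neq1 andbF mulr0.
  by [].
Qed.

(** The multiplicity of 'chi_j is bounded by both ranks, hence zero for j != i and at most one for j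
    = i; it is not zero throughout since the module is nonzero. *)
Lemma chi_alpha : chi mu = alphaCF n muf.
Proof.
have [i alpha_i] := alphaCF_irr part_fun_dec sum_part_fun.
have [r_i rs0] := row_col_rank alpha_i.
have R_row : (row_sum_mx \in enveloping_algebra_mx aG)%MS.
  by rewrite linear_sum summx_sub // => p _; apply: envelop_mx_id; rewrite inE.
have R_col : (col_sum_mx \in enveloping_algebra_mx aG)%MS.
  rewrite linear_sum summx_sub // => q _; rewrite linearZ /= scalemx_sub //.
  by apply: envelop_mx_id; rewrite inE.
have mult j : exists2 k : nat, '[chi mu, 'chi_j] = k%:R & (k <= row_rank j)%N && (k <= col_rank j)%N.
  have [k [km kr kc]] := cyclic_product_mult j young_symmetrizerE R_row R_col.
  exists k => //; move: kr kc.
  have -> : gring_op 'Chi_j row_sum_mx = \sum_(p in stabc d_row) 1 *: 'Chi_j p.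
    by rewrite linear_sum; apply: eq_bigr => p _; rewrite [LHS]gring_opG ?inE // scale1r.
  have -> : gring_op 'Chi_j col_sum_mx
      = \sum_(q in stabc d_col) (-1) ^+ (q : bool) *: 'Chi_j q.
    by rewrite linear_sum; apply: eq_bigr => q _; rewrite linearZ /= gring_opG ?inE.
  by move=> -> ->.
have [k k_i k_le] := mult i; rewrite r_i in k_le.
have chi_k : chi mu = k%:R *: 'chi_i.
  rewrite [LHS]cfun_sum_cfdot (bigD1 i) //= k_i big1 ?addr0 // => j j_neq.
  have [k' -> /andP[k_r k_s]] := mult j.
  have /eqP := rs0 j j_neq; rewrite muln_eq0 => /orP[] /eqP z0.
    by move: k_r; rewrite z0 leqn0 => /eqP->; rewrite scale0r.
  by move: k_s; rewrite z0 leqn0 => /eqP->; rewrite scale0r.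
have chi_neq0 : chi mu 1%g != 0.
  rewrite /chi cfRepr1 pnatr_eq0 mxrank_eq0 cyclic_mx_eq0.
  exact: young_symmetrizer_neq0.
move: k_le chi_k chi_neq0; case: k {k_i} => [|[|k]] // _ ->; rewrite ?scale0r ?cfunE ?eqxx //.
by rewrite scale1r alpha_i.
Qed.

End SpechtCharacter.

(** * Character polynomials on cycle types *)

Definition addc l (a : {ffun 'I_l -> nat}) (i : 'I_l) (x : nat) : {ffun 'I_l -> nat} :=
  [ffun j => (a j + (j == i) * x)%N].

(* t lists cycle lengths, and the accumulator a is the content coloured so far. *)
Fixpoint color_sum l (F : {ffun 'I_l -> nat} -> algC) (t : seq nat)
    (a : {ffun 'I_l -> nat}) : algC :=
  if t is x :: t' then \sum_i color_sum F t' (addc a i x) else F a.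

Definition cyc n (s : 'S_n) : seq nat := [seq #|c| | c : {set 'I_n} in porbits s].

Lemma addcC l (a : {ffun 'I_l -> nat}) i x j y :
  addc (addc a i x) j y = addc (addc a j y) i x.
Proof. by apply/ffunP=> k; rewrite !ffunE addnAC. Qed.

Lemma sum_addc l (a : {ffun 'I_l -> nat}) i x :
  (\sum_j addc a i x j = \sum_j a j + x)%N.
Proof.
rewrite (eq_bigr (fun j => a j + (j == i) * x)%N) => [|j _]; last by rewrite ffunE.
rewrite big_split /=; congr addn; rewrite (bigD1 i) //= eqxx mul1n big1 ?addn0 //.
by move=> j /negPf->.
Qed.

Lemma eq_color_sum l (F F' : {ffun 'I_l -> nat} -> algC) t (a : {ffun 'I_l -> nat}) :
  (forall b : {ffun 'I_l -> nat}, (\sum_i b i = \sum_i a i + sumn t)%N -> F b = F' b) ->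
  color_sum F t a = color_sum F' t a.
Proof.
elim: t a => [|x t IHt] a FF' /=; first by apply: FF'; rewrite addn0.
by apply: eq_bigr => i _; apply: IHt => b b_sum; apply: FF'; rewrite b_sum sum_addc addnA.
Qed.

Lemma color_sum_lin l (I : Type) (r : seq I) (e : I -> algC)
    (F : I -> {ffun 'I_l -> nat} -> algC) t a :
  \sum_(k <- r) e k * color_sum (F k) t a
  = color_sum (fun b => \sum_(k <- r) e k * F k b) t a.
Proof.
elim: t a => [//|x t IHt] a /=; under eq_bigr do rewrite mulr_sumr.
by rewrite exchange_big /=; apply: eq_bigr => i _; rewrite IHt.
Qed.

Lemma color_sum_opp l (F : {ffun 'I_l -> nat} -> algC) t a :
  color_sum (fun b => - F b) t a = - color_sum F t a.
Proof.
elim: t a => [//|x t IHt] a /=; rewrite -sumrN.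
by apply: eq_bigr => i _; rewrite IHt.
Qed.

Lemma color_sum_swap l (F : {ffun 'I_l -> nat} -> algC) x y t a :
  color_sum F [:: x, y & t] a = color_sum F [:: y, x & t] a.
Proof.
rewrite /= exchange_big /=; apply: eq_bigr => i _; apply: eq_bigr => j _.
by rewrite addcC.
Qed.

Lemma color_sum_perm l (F : {ffun 'I_l -> nat} -> algC) t u a :
  perm_eq t u -> color_sum F t a = color_sum F u a.
Proof.
elim: t u a => [|x t IHt] u a; first by rewrite perm_sym => /perm_nilP->.
have move_front v w b : color_sum F (v ++ x :: w) b = color_sum F (x :: v ++ w) b.
  elim: v b => [//|y v IHv] b; rewrite -[RHS]color_sum_swap /=.
  by apply: eq_bigr => i _; rewrite IHv.
move=> xtu; have /splitPr xu : x \in u by rewrite -(perm_mem xtu) mem_head.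
case: xu xtu => v w xtu; rewrite move_front /=; apply: eq_bigr => i _; apply: IHt.
rewrite -(perm_cons x); apply: perm_trans xtu _.
by rewrite perm_catC /= perm_cons perm_catC.
Qed.

Lemma color_sum_tperm l (F : {ffun 'I_l -> nat} -> algC) (s : 'S_l) t (a : {ffun 'I_l -> nat}) :
  color_sum F t [ffun i => a (s i)] = color_sum (fun b => F [ffun i => b (s i)]) t a.
Proof.
elim: t a => [//|x t IHt] a /=; rewrite [RHS](reindex_inj (@perm_inj _ s)) /=.
apply: eq_bigr => i _; rewrite -IHt; congr color_sum; apply/ffunP=> j.
by rewrite !ffunE (inj_eq (@perm_inj _ s)).
Qed.

Lemma color_sumE l (F : {ffun 'I_l -> nat} -> algC) t a :
  color_sum F t a = \sum_(k : {ffun 'I_(size t) -> 'I_l})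
    F [ffun i => a i + \sum_(j < size t) (i == k j) * nth 0 t j]%N.
Proof.
elim: t a => [|x t IHt] a /=.
  rewrite (big_pred1 (ffun0 (card_ord 0))).
    by congr F; apply/ffunP => i; rewrite ffunE big_ord0 addn0.
  by move=> k; apply/esym/eqP/ffunP=> -[].
rewrite (big_fcons ord0) /=; apply: eq_bigr => i _; rewrite IHt; apply: eq_bigr => k _.
congr F; apply/ffunP=> j; rewrite !ffunE big_ord_recl fcons_id /= -addnA.
by congr (_ + (_ + _))%N; apply: eq_bigr => m _; rewrite fcons_lift.
Qed.

Lemma pfix_porbit (I : finType) n (s : 'S_n) (c : {ffun 'I_n -> I}) x y :
  pfix s c -> y \in porbit s x -> c y = c x.
Proof.
move=> /pfixP cs /porbitP[i ->]; elim: i => [|i IHi]; first by rewrite expg0 perm1.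
by rewrite expgSr permM cs.
Qed.

(** An invariant colouring is constant on cycles, hence is a colouring of the list of cycles. This
    gives alpha a meaning on any list of lengths. *)
Lemma sum_pfix_cyc l n (s : 'S_n) (F : {ffun 'I_l -> nat} -> algC) :
  \sum_(c : {ffun 'I_n -> 'I_l} | pfix s c) F (content c)
  = color_sum F (cyc s) [ffun=> 0%N].
Proof.
rewrite color_sumE; set T := size (cyc s); pose q := enum (porbits s).
have q_T : size q = T by rewrite /T size_map.
have x_q x : porbit s x \in q by rewrite mem_enum; apply/imsetP; exists x.
have idx_lt x : (index (porbit s x) q < T)%N by rewrite -q_T index_mem.
pose idx x : 'I_T := Ordinal (idx_lt x).
have ex_rep (j : 'I_T) : exists x, porbit s x == nth set0 q j.
  have : nth set0 q j \in q by rewrite mem_nth // q_T.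
  by rewrite mem_enum => /imsetP[x _ ->]; exists x.
pose rep j := xchoose (ex_rep j).
have repP j : porbit s (rep j) = nth set0 q j by apply/eqP/(xchooseP (ex_rep j)).
have idxP x j : (idx x == j) = (x \in nth set0 q j).
  rewrite -val_eqE /= -repP -eq_porbit_mem; apply/eqP/eqP => [xj|->].
    by rewrite repP -xj nth_index.
  by rewrite repP index_uniq ?enum_uniq // q_T.
have idx_rep j : idx (rep j) = j by apply/eqP; rewrite idxP -repP porbit_id.
pose cK (k : {ffun 'I_T -> 'I_l}) : {ffun 'I_n -> 'I_l} := [ffun x => k (idx x)].
pose kC (c : {ffun 'I_n -> 'I_l}) : {ffun 'I_T -> 'I_l} := [ffun j => c (rep j)].
rewrite (reindex_onto cK kC) => [|c cs]; last first.
  apply/ffunP => x; rewrite !ffunE; apply: (pfix_porbit cs).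
  by rewrite porbit_sym repP -idxP.
apply: eq_big => [k|k _].
  have -> : kC (cK k) = k by apply/ffunP => j; rewrite !ffunE idx_rep.
  rewrite eqxx andbT; apply/pfixP=> x; rewrite !ffunE; congr (k _).
  by apply/eqP; rewrite idxP /= nth_index // -{1}[s]expg1 mem_porbit.
congr F; apply/ffunP=> i; rewrite !ffunE add0n -sum1_card.
rewrite (partition_big idx xpredT) //=; apply: eq_bigr => j _.
rewrite sum1dep_card (nth_map set0) ?q_T ?ltn_ord //.
have [->|i_neq] := eqVneq i (k j).
  by rewrite mul1n; apply: eq_card => x; rewrite !inE ffunE -[RHS]idxP; case: (idx x =P j) => [->|_]; rewrite ?eqxx ?andbF.
rewrite mul0n; apply: eq_card0 => x; rewrite !inE ffunE; apply/negP => /andP[/eqP xi /eqP xj].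
by case/eqP: i_neq; rewrite -xi xj.
Qed.

Lemma succ_modn_inj a b m :
  (a < m)%N -> (b < m)%N -> (a.+1 = b.+1 %[mod m])%N -> a = b.
Proof.
move=> am bm /eqP; rewrite -(addn1 a) -(addn1 b) eqn_modDr !modn_small //.
by move/eqP.
Qed.

Lemma succ_modn_add a i m : (((a + i) %% m).+1 = a + i.+1 %[mod m])%N.
Proof. by rewrite addnS -addn1 modnDml addn1. Qed.

Section CycleTypePerm.

Variables (rho : seq nat).
Hypothesis (rho_part : is_part rho).
Local Notation n := (sumn rho).

Lemma block_rot_lt (x : 'I_n) :
  ((reshape_offset rho x).+1 %% nth 0 rho (reshape_index rho x)
     < nth 0 rho (reshape_index rho x))%N.
Proof. by rewrite ltn_mod (leq_ltn_trans _ (reshape_offsetP (ltn_ord x))). Qed.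

(** Rotates each row of the tableau of shape rho by one step, so that the rows become the cycles. It
    ensures that [chi_val] does not fall back on its default at a partition of |mu|. *)
Definition block_rot (x : 'I_n) : 'I_n := Ordinal (flatten_indexP (block_rot_lt x)).

Lemma block_rot_row x : reshape_index rho (block_rot x) = reshape_index rho x.
Proof. by rewrite /= flatten_indexKl // block_rot_lt. Qed.

Lemma block_rot_off x :
  reshape_offset rho (block_rot x)
  = ((reshape_offset rho x).+1 %% nth 0 rho (reshape_index rho x))%N.
Proof. by rewrite /= flatten_indexKr // block_rot_lt. Qed.

Lemma row_off_inj (x y : 'I_n) :
  reshape_index rho x = reshape_index rho y ->
  reshape_offset rho x = reshape_offset rho y -> x = y.
Proof.
move=> rxy oxy; apply: val_inj.
by rewrite -[LHS](reshape_indexK rho) rxy oxy reshape_indexK.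
Qed.

Lemma block_rot_inj : injective block_rot.
Proof.
move=> x y xy; have r_xy : reshape_index rho x = reshape_index rho y.
  by rewrite -block_rot_row xy block_rot_row.
have y_lt := reshape_offsetP (ltn_ord y); rewrite -r_xy in y_lt.
apply: (row_off_inj r_xy (succ_modn_inj (reshape_offsetP (ltn_ord x)) y_lt _)).
by rewrite -(block_rot_off x) xy (block_rot_off y) r_xy.
Qed.

Lemma block_rot_iter i x :
  reshape_index rho ((perm block_rot_inj ^+ i)%g x) = reshape_index rho x
  /\ reshape_offset rho ((perm block_rot_inj ^+ i)%g x)
     = ((reshape_offset rho x + i) %% nth 0 rho (reshape_index rho x))%N.
Proof.
elim: i => [|i [IHr IHo]].
  by rewrite expg0 perm1 addn0 modn_small // reshape_offsetP.
rewrite expgSr permM permE block_rot_row block_rot_off IHr IHo; split=> //.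
exact: succ_modn_add.
Qed.

Lemma block_rot_porbit x :
  porbit (perm block_rot_inj) x = [set y : 'I_n | reshape_index rho y == reshape_index rho x].
Proof.
apply/setP=> y; rewrite inE; apply/porbitP/eqP => [[i ->]|yx].
  by have [] := block_rot_iter i x.
have x_lt := reshape_offsetP (ltn_ord x); have y_lt := reshape_offsetP (ltn_ord y).
rewrite yx in y_lt.
exists (reshape_offset rho y + (nth 0 rho (reshape_index rho x) - reshape_offset rho x))%N.
set i := (X in (_ ^+ X)%g); have [ri oi] := block_rot_iter i x.
apply: row_off_inj; rewrite ?ri // oi /i addnCA subnKC ?(ltnW x_lt) //.
by rewrite modnDr modn_small.
Qed.

Lemma cyc_block_rot : perm_eq (cyc (perm block_rot_inj)) rho.
Proof.
pose blk r : {set 'I_n} := [set y : 'I_n | reshape_index rho y == r].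
have blk_card r : (r < size rho)%N -> #|blk r| = nth 0%N rho r.
  move=> r_lt; have /ffunP/(_ (Ordinal r_lt)) := content_row (leqnn (size rho)).
  by rewrite !ffunE /= => <-; apply: eq_card => y; rewrite !inE ffunE -val_eqE.
have blk0 r : (r < size rho)%N -> (0 < nth 0 rho r)%N.
  move=> r_lt; rewrite lt0n; apply: contraL rho_part => /eqP r0.
  by rewrite /is_part negb_and negbK -r0 mem_nth ?orbT.
suff cycE : perm_eq (cyc (perm block_rot_inj))
    [seq #|c| | c : {set 'I_n} <- [seq blk r | r <- iota 0 (size rho)]].
  rewrite [X in perm_eq _ X](_ : _ = [seq #|c| | c : {set 'I_n} <- [seq blk r | r <- iota 0 (size rho)]]) //.
  apply: (@eq_from_nth _ 0%N) => [|r r_lt]; first by rewrite !size_map size_iota.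
  by rewrite (nth_map set0) ?size_map ?size_iota // (nth_map 0%N) ?size_iota // nth_iota // blk_card.
apply: perm_map; apply: uniq_perm; rewrite ?enum_uniq //.
  rewrite map_inj_in_uniq ?iota_uniq // => r r'; rewrite !mem_iota !add0n /= => r_lt r'_lt.
  move=> blk_eq; have /set0Pn[y] : blk r != set0 by rewrite -card_gt0 blk_card ?blk0.
  by move=> /[dup]; rewrite {2}blk_eq !inE => /eqP <- /eqP.
move=> c; rewrite mem_enum; apply/imsetP/mapP => [[x _ ->]|[r]].
  exists (reshape_index rho x); last exact: block_rot_porbit.
  by rewrite mem_iota reshape_indexP.
rewrite mem_iota add0n => /= r_lt ->; have /set0Pn[y] : blk r != set0 by rewrite -card_gt0 blk_card ?blk0.
by rewrite inE => /eqP y_r; exists y => //; rewrite block_rot_porbit y_r.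
Qed.

End CycleTypePerm.

Lemma sort_geq_part rho t : is_part rho -> perm_eq t rho -> sort geq t = rho.
Proof.
move=> /part_sorted rho_sorted t_rho.
have geq_total : total geq by move=> x y; rewrite /geq /= leq_total.
have geq_trans : transitive geq by move=> ? ? ? /[swap]; apply: leq_trans.
have geq_anti : antisymmetric geq by move=> x y /andP[? ?]; apply/eqP; rewrite eqn_leq; apply/andP.
apply: (sorted_eq geq_trans geq_anti) => //; first exact: sort_sorted.
by rewrite perm_sort.
Qed.

Lemma chi_val_color_sum l mu rho : is_part mu -> (size mu <= l)%N ->
  is_part_of (sumn mu) rho ->
  chi_val mu rho = color_sum (jt (part_fun l mu)) rho [ffun=> 0%N].
Proof.
move=> mu_part mu_l /andP[rho_part /eqP rho_mu]; rewrite /chi_val.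
case: pickP => [s /eqP s_rho|no_s]; last first.
  move: no_s; rewrite -rho_mu => /(_ (perm (@block_rot_inj rho)))/eqP[].
  exact: (sort_geq_part rho_part (cyc_block_rot rho_part)).
rewrite (chi_alpha mu_part mu_l) alphaCFE /alpha sum_pfix_cyc.
by apply: color_sum_perm; rewrite -s_rho perm_sym perm_sort.
Qed.

(** * Choosing some of the cycles *)

Fixpoint subs (t : seq nat) : seq (seq nat) :=
  if t is x :: t' then subs t' ++ map (cons x) (subs t') else [:: [::]].

(** [subs] has one entry for each set of positions, so distinct cycles of equal length are told
    apart, and the binomials of I_rho count the choices of type rho. The induction is Pascal's rule
    at the length of the first cycle. *)
Lemma count_subs t (rho : seq nat) N :
  (forall x, x \in rho -> (0 < x < N)%N) ->
  count (perm_eq rho) (subs t)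
  = (\prod_(1 <= j < N) 'C(count_mem j t, count_mem j rho))%N.
Proof.
elim: t rho => [|x t IHt] rho rhoN /=.
  rewrite addn0; case: rho rhoN => [|y rho] rhoN.
    by rewrite perm_refl big1.
  have y_N : y \in index_iota 1 N by rewrite mem_index_iota rhoN ?mem_head.
  by rewrite (bigD1_seq y) ?iota_uniq //= eqxx bin0n mul0n; case: perm_nilP.
rewrite count_cat count_map IHt //.
have [x_rho|x_rho] := boolP (x \in rho); last first.
  rewrite (eq_count (a2 := pred0)) ?count_pred0 ?addn0 => [|u]; last first.
    by apply/negP => /perm_mem/(_ x); rewrite (negPf x_rho) mem_head.
  apply: eq_bigr => j _; case: eqP => [<-|]; rewrite ?add0n //.
  by rewrite (count_memPn x_rho) !bin0.
rewrite (eq_count (a2 := perm_eq (rem x rho))) => [|u]; last first.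
  by rewrite /= (permPl (perm_to_rem x_rho)) perm_cons.
rewrite IHt => [|y y_rem]; last by apply: rhoN; apply: mem_rem y_rem.
have x_N : x \in index_iota 1 N by rewrite mem_index_iota rhoN.
rewrite !(bigD1_seq x x_N (iota_uniq _ _)) /= eqxx add1n.
have count_rem j : count_mem j rho = ((x == j) + count_mem j (rem x rho))%N.
  by rewrite (seq.permP (perm_to_rem x_rho)).
rewrite [count_mem x rho]count_rem eqxx add1n binS mulnDl; congr (_ * _ + _ * _)%N.
  by apply: eq_bigr => j; rewrite eq_sym => /negPf ->.
by apply: eq_bigr => j j_neq; rewrite count_rem eq_sym (negPf j_neq).
Qed.

Lemma ncycles_cyc j n (s : 'S_n) : ncycles j s = count_mem j (cyc s).
Proof.
rewrite /ncycles /cyc count_map -sum1_count big_enum_cond /= -sum1_card.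
by apply: eq_bigl => c; rewrite inE.
Qed.

Lemma cyc_gt0 n (s : 'S_n) x : x \in cyc s -> (0 < x)%N.
Proof.
case/mapP => c; rewrite mem_enum => /imsetP[y _ ->] ->.
by apply/card_gt0P; exists y; apply: porbit_id.
Qed.

Lemma subs_mem t u x : u \in subs t -> x \in u -> x \in t.
Proof.
elim: t u => [|y t IHt] u /=; first by rewrite inE => /eqP->.
rewrite mem_cat => /orP[/IHt h /h|/mapP[v /IHt h ->]]; first by rewrite inE orbC => ->.
by rewrite !inE => /orP[->//|/h->]; rewrite orbT.
Qed.

Lemma jt_sum0 l (mu a : {ffun 'I_l -> nat}) :
  (\sum_i a i)%N <> (\sum_i mu i)%N -> jt mu a = 0.
Proof.
move=> a_mu; rewrite jtE big1 // => w /forallP w_ok; case: eqP => [aw|]; last by rewrite mulr0.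
case: a_mu; have : (\sum_i (a i + i) = \sum_i (mu i + w i))%N.
  by apply: eq_bigr => i _; rewrite aw ffunE subnK.
rewrite !big_split /= [X in (_ = _ + X)%N -> _](_ : _ = \sum_(i < l) i)%N; first by move/addIn.
by rewrite [RHS](reindex_inj (@perm_inj _ w)).
Qed.

Lemma color_sum0 l t (a : {ffun 'I_l -> nat}) : color_sum (fun=> 0) t a = 0.
Proof. by elim: t a => [//|x t IHt] a /=; rewrite big1. Qed.

(** I_rho counts the choices of cycles of type rho, so Y^mu sums the character formula over chosen
    cycles of total length |mu|. Choices of any other length contribute 0, since [jt] vanishes on
    contents of the wrong sum. *)
Lemma Y_color_sum l mu n (s : 'S_n) : is_part mu -> (size mu <= l)%N ->
  Y mu s = \sum_(t <- subs (cyc s)) color_sum (jt (part_fun l mu)) t [ffun=> 0%N].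
Proof.
move=> mu_part mu_l; rewrite /Y.
transitivity (\sum_(rho <- parts (sumn mu)) \sum_(t <- subs (cyc s))
   (perm_eq rho t)%:R * color_sum (jt (part_fun l mu)) t [ffun=> 0%N]).
  rewrite big_seq [RHS]big_seq; apply: eq_bigr => rho; rewrite mem_parts => rho_mu.
  have /andP[/andP[_ rho0] /eqP rho_sum] := rho_mu.
  have -> : Ibin rho s = count (perm_eq rho) (subs (cyc s)).
    rewrite (@count_subs _ _ (sumn rho).+1) => [|x x_rho].
      by apply: eq_bigr => j _; rewrite ncycles_cyc.
    rewrite lt0n (memPn rho0) //= ltnS.
    by rewrite (perm_sumn (perm_to_rem x_rho)) leq_addr.
  rewrite (chi_val_color_sum mu_part mu_l rho_mu) -sum1_count natr_sum mulr_sumr.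
  rewrite big_mkcond; apply: eq_bigr => t _; case: ifP => rho_t; last by rewrite mul0r.
  by rewrite mulr1 mul1r (color_sum_perm _ _ rho_t).
rewrite exchange_big /= big_seq [RHS]big_seq; apply: eq_bigr => t t_s.
rewrite -mulr_suml; have [t_mu|t_mu] := eqVneq (sumn t) (sumn mu); last first.
  rewrite (eq_color_sum (F' := fun=> 0)) ?color_sum0 ?mulr0 // => b b_t.
  apply: jt_sum0; rewrite b_t (sum_part_fun mu_l).
  by rewrite big1 => [|i _]; [apply/eqP | rewrite ffunE].
have t_sort : perm_eq (sort geq t) t by rewrite perm_sort.
have geq_total : total geq by move=> x y; rewrite /geq /= leq_total.
have t_part : is_part_of (sumn mu) (sort geq t).
  rewrite /is_part_of /is_part sort_sorted //= mem_sort.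
  rewrite (perm_sumn t_sort) t_mu eqxx andbT; apply/negP => /(subs_mem t_s)/cyc_gt0.
  by rewrite ltnn.
rewrite (bigD1_seq (sort geq t)) ?parts_uniq ?mem_parts //= t_sort big_seq_cond big1 ?addr0 ?mul1r //.
move=> rho /andP[]; rewrite mem_parts => /andP[rho_part _] rho_neq.
case rho_t: (perm_eq rho t) => //; case/eqP: rho_neq.
by apply/esym/sort_geq_part => //; rewrite perm_sym.
Qed.

(** * Macdonald's formula *)

(** When nu_(i+1) = nu_i + 1, rows i and i + 1 of the matrix depend in the same way on their entries
    of b, so exchanging the entries exchanges the rows. *)
Lemma jt_tperm l (nu b : {ffun 'I_l -> nat}) (i j : 'I_l) :
  val j = i.+1 -> nu j = (nu i).+1 ->
  jt nu [ffun k => b (tperm i j k)] = - jt nu b.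
Proof.
move=> ji nuj; have i_neq_j : i != j by rewrite -val_eqE /= ji neq_ltn ltnSn.
have sgn : (-1) ^+ (tperm i j : bool) = -1 :> algC by rewrite odd_tperm i_neq_j expr1.
rewrite -[RHS]mulN1r -sgn.
rewrite -det_perm -det_mulmx -row_permE; congr (\det _).
apply/matrixP=> r k; rewrite !mxE ffunE; congr (nat_of_bool _)%:R.
by case: tpermP => [->|->|_ _] //; rewrite nuj ji addnS addSn eqSS.
Qed.

(** The colour sum is symmetric under renaming colours, while [jt] changes sign under this
    exchange. *)
Lemma color_sum_jt0 l (nu : {ffun 'I_l -> nat}) t (i j : 'I_l) :
  val j = i.+1 -> nu j = (nu i).+1 -> color_sum (jt nu) t [ffun=> 0%N] = 0.
Proof.
move=> ji nuj; apply: eq_oppr0; rewrite -color_sum_opp.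
have a0 : [ffun=> 0%N] = [ffun k => [ffun=> 0%N] (tperm i j k)] :> {ffun 'I_l -> nat}.
  by apply/ffunP=> k; rewrite !ffunE.
rewrite {1}a0 color_sum_tperm; apply: eq_color_sum => b _.
exact: jt_tperm.
Qed.

Definition jt_diff l (la b : {ffun 'I_l -> nat}) : algC :=
  \det (\matrix_(i, j < l) ((b i + i == la i + j)%N%:R - (b i + i.+1 == la i + j)%N%:R)).

(** Multilinearity in the rows: a box taken from row i replaces la_i by la_i - 1 in that row alone,
    so the alternating sum becomes a determinant of row differences. Positivity of la_i keeps the
    truncated subtraction exact. *)
Lemma jt_diffE l (la b : {ffun 'I_l -> nat}) : (forall i, (0 < la i)%N) ->
  \sum_(e : {ffun 'I_l -> bool}) (-1) ^+ (\sum_i e i) * jt [ffun i => la i - e i]%N b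
  = jt_diff la b.
Proof.
move=> la_gt0; under eq_bigr do rewrite mulr_sumr.
rewrite exchange_big /=; apply: eq_bigr => w _.
under eq_bigr do rewrite mulrCA; rewrite -mulr_sumr; congr (_ * _).
transitivity (\prod_i \sum_(e : bool) (-1) ^+ e * (b i + i == (la i - e) + w i)%N%:R : algC).
  rewrite bigA_distr_bigA /=; apply: eq_bigr => e _.
  rewrite big_split /= (big_morph (fun k => (-1) ^+ k : algC) (exprD _) (expr0 _)).
  by congr (_ * _); apply: eq_bigr => i _; rewrite mxE ffunE.
apply: eq_bigr => i _; rewrite big_bool mxE /= expr1 mulN1r expr0 mul1r subn0 addrC.
congr (_ - (nat_of_bool _)%:R); have := la_gt0 i; case: (la i) => // k _.
by rewrite subn1 /= addnS addSn eqSS.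
Qed.

(** The cycles left out of u are those given colour 0, whose count F ignores. *)
Lemma subs_color_sum l (F : {ffun 'I_l -> nat} -> algC) t (a : {ffun 'I_l.+1 -> nat}) :
  \sum_(u <- subs t) color_sum F u [ffun i => a (lift ord0 i)]
  = color_sum (fun b : {ffun 'I_l.+1 -> nat} => F [ffun i => b (lift ord0 i)]) t a.
Proof.
elim: t a => [|x t IHt] a /=; first by rewrite big_seq1.
rewrite big_cat big_map /= big_ord_recl -IHt; congr (_ + _).
  apply: eq_bigr => u _; congr color_sum; apply/ffunP=> i.
  by rewrite !ffunE (_ : (lift ord0 i == ord0) = false) ?addn0.
rewrite exchange_big /=; apply: eq_bigr => i _; rewrite -IHt; apply: eq_bigr => u _.
by congr color_sum; apply/ffunP=> j; rewrite !ffunE (inj_eq lift_inj).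
Qed.

(* Subtracting from each column the previous one turns the first row, which
   can be replaced by ones since the sum of a is fixed, into (1, 0, ..., 0). *)
Lemma jt_border l (nu a : {ffun 'I_l.+1 -> nat}) :
  (\sum_i a i = \sum_i nu i)%N ->
  jt nu a = jt_diff [ffun i => nu (lift ord0 i)] [ffun i => a (lift ord0 i)].
Proof.
move=> a_nu; pose B : 'M[algC]_l.+1 := \matrix_(i, j)
  (if i == ord0 then 1 else (a i + i == nu i + j)%N%:R).
have -> : jt nu a = \det B.
  apply: eq_bigr => w _; congr (_ * _); rewrite !big_ord_recl !mxE /= mul1r.
  rewrite [X in _ * X = _](eq_bigr (fun i => B (lift ord0 i) (w (lift ord0 i)))) => [|i _]; last by rewrite !mxE.
  have [/forallP h|/forallPn[i h]] := boolP [forall i, a (lift ord0 i) + lift ord0 i == nu (lift ord0 i) + w (lift ord0 i)]%N.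
    suff -> : (a ord0 + @ord0 l == nu ord0 + w ord0)%N by rewrite mul1r.
    have : (\sum_i (a i + i) = \sum_i (nu i + w i))%N.
      rewrite !big_split /= a_nu; congr addn.
      by rewrite [LHS](reindex_inj (@perm_inj _ w)).
    rewrite !big_ord_recl /=.
    rewrite [X in (_ + X = _)%N -> _](eq_bigr (fun i => nu (lift ord0 i) + w (lift ord0 i))%N); last by move=> i _; rewrite -(eqP (h i)).
    by move/addIn => /eqP.
  by rewrite (bigD1 i) //= !mxE /= (negPf h) mul0r mulr0.
pose U : 'M[algC]_l.+1 := \matrix_(j, k) ((j == k)%:R - (j.+1 == k)%:R).
have detU : \det U = 1.
  rewrite -det_tr det_trig; last first.
    apply/is_trig_mxP => k j kj; rewrite !mxE -val_eqE /= gtn_eqF //.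
    by rewrite gtn_eqF ?subrr // ltnS ltnW.
  by apply: big1 => k _; rewrite !mxE eqxx gtn_eqF ?subr0.
have UE j k : U j k = (j == k)%:R - (j.+1 == k)%:R by rewrite mxE.
have BU0 i : (B *m U) i ord0 = B i ord0.
  rewrite mxE (bigD1 ord0) //= UE eqxx subr0 mulr1 big1 ?addr0 // => j /negPf j0.
  by rewrite UE j0 subr0 mulr0.
have BU1 i k : (B *m U) i (lift ord0 k) = B i (lift ord0 k) - B i (widen_ord (leqnSn l) k).
  rewrite mxE; under eq_bigr do rewrite UE mulrBr.
  rewrite sumrB; congr (_ - _).
    rewrite (bigD1 (lift ord0 k)) //= eqxx mulr1 big1 ?addr0 // => j /negPf ->.
    by rewrite mulr0.
  rewrite (bigD1 (widen_ord (leqnSn l) k)) //= eqxx mulr1 big1 ?addr0 // => j.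
  by rewrite -val_eqE /= eqSS => /negPf ->; rewrite mulr0.
have -> : \det B = \det (B *m U) by rewrite det_mulmx detU mulr1.
rewrite (expand_det_row _ ord0) big_ord_recl BU0 mxE /= mul1r.
rewrite big1 ?addr0 => [|k _]; last by rewrite BU1 !mxE /= subrr mul0r.
rewrite /cofactor /= addn0 expr0 mul1r; congr (\det _).
apply/matrixP=> i k; rewrite [LHS]mxE [LHS]mxE BU1 !mxE !ffunE /= /bump /= !add1n.
by rewrite !addnS eqSS.
Qed.

Lemma sumn_cyc n (s : 'S_n) : sumn (cyc s) = n.
Proof.
rewrite sumnE big_image /= -[RHS]card_ord -[RHS]sum1_card.
rewrite [RHS](partition_big (porbit s) [in porbits s]) => [|x _]; last exact: imset_f.
apply: eq_bigr => c /imsetP[y _ ->]; rewrite -sum1_card; apply: eq_bigl => x.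
by rewrite -eq_porbit_mem eq_sym.
Qed.

(** * Vertical strips as sets of rows *)

Section VerticalStrips.

Variable la : seq nat.
Hypothesis la_part : is_part la.
Local Notation l := (size la).

(** Here e marks the rows losing a box; it is arbitrary, so the result need not be weakly
    decreasing. *)
Definition strip_fun (e : {ffun 'I_l -> bool}) : {ffun 'I_l -> nat} :=
  [ffun i => part_fun l la i - e i]%N.

Definition strip_seq (e : {ffun 'I_l -> bool}) : seq nat :=
  [seq x <- [seq strip_fun e i | i <- enum 'I_l] | (0 < x)%N].

Definition strip_dec (e : {ffun 'I_l -> bool}) : bool :=
  [forall i : 'I_l, forall j : 'I_l, (val j == i.+1) ==> (strip_fun e j <= strip_fun e i)%N].

Lemma part_fun_gt0 (i : 'I_l) : (0 < part_fun l la i)%N.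
Proof.
have /andP[_ la0] := la_part.
rewrite ffunE lt0n; apply: contraNneq la0 => i0; rewrite -[X in X \in _]i0. exact: (mem_nth _ (ltn_ord i)).
Qed.

Lemma nth_strip_fun e (i : nat) : nth 0%N [seq strip_fun e i | i <- enum 'I_l] i
  = if insub i is Some j then strip_fun e j else 0%N.
Proof.
case: insubP => [j _ <-|i_l]; last by rewrite nth_default // size_map size_enum_ord leqNgt.
by rewrite (nth_map j) ?nth_ord_enum // size_enum_ord ltn_ord.
Qed.

Lemma strip_sorted e : strip_dec e -> sorted geq [seq strip_fun e i | i <- enum 'I_l].
Proof.
move=> /forallP e_dec; apply/(sortedP 0%N) => i; rewrite size_map size_enum_ord => i_l.
rewrite !nth_strip_fun (insubT (fun k => k < l)%N i_l) (insubT (fun k => k < l)%N (ltnW i_l)) /=.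
by have /forallP/(_ (Sub i.+1 i_l)) := e_dec (Sub i (ltnW i_l)); rewrite eqxx.
Qed.

Lemma nth_filter_pos (v : seq nat) i :
  sorted geq v -> nth 0%N [seq x <- v | (0 < x)%N] i = nth 0%N v i.
Proof.
elim: v i => [//|x v IHv] i v_sorted /=.
case: ltnP => [_|]; first by case: i => //= i; rewrite IHv // (path_sorted v_sorted).
rewrite leqn0 => /eqP x0.
have v0 j : nth 0%N (x :: v) j = 0%N.
  by apply/eqP; rewrite -leqn0 -{2}x0; apply: (sorted_nth_dec v_sorted (leq0n j)).
rewrite -[RHS]/(nth 0%N (x :: v) i) v0 IHv; first exact: (v0 i.+1).
exact: (path_sorted v_sorted).
Qed.

Lemma nth_strip_seq e (i : 'I_l) : strip_dec e -> nth 0%N (strip_seq e) i = strip_fun e i.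
Proof.
by move=> /strip_sorted e_sorted; rewrite nth_filter_pos // nth_strip_fun valK.
Qed.

Lemma size_strip_seq e : (size (strip_seq e) <= l)%N.
Proof. by rewrite size_filter (leq_trans (count_size _ _)) // size_map size_enum_ord. Qed.

Lemma part_fun_strip e : strip_dec e -> part_fun l (strip_seq e) = strip_fun e.
Proof. by move=> e_dec; apply/ffunP=> i; rewrite ffunE nth_strip_seq. Qed.

Lemma strip_part e : strip_dec e -> is_part (strip_seq e).
Proof.
move=> /strip_sorted e_sorted; have geq_trans : transitive geq by move=> ? ? ? /[swap]; apply: leq_trans.
by rewrite /is_part sorted_filter // mem_filter.
Qed.

Lemma sumn_strip e : (sumn (strip_seq e) + \sum_i e i = sumn la)%N.
Proof.
have -> : sumn (strip_seq e) = (\sum_i strip_fun e i)%N.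
  rewrite sumnE big_filter big_mkcond big_map big_enum /=; apply: eq_bigr => i _.
  by case: ltnP => //; rewrite leqn0 => /eqP.
rewrite -(sum_part_fun (leqnn l)) -big_split; apply: eq_bigr => i _.
by rewrite ffunE /= subnK //; case: (e i) => //; apply: part_fun_gt0.
Qed.

Lemma vstrip_nth mu i : vstrip mu la -> (nth 0 mu i <= nth 0 la i <= (nth 0 mu i).+1)%N.
Proof.
case/andP=> _ /forallP h; have [i_lt|] := ltnP i (maxn (size mu) l).
  exact: (h (Ordinal i_lt)).
by rewrite geq_max => /andP[? ?]; rewrite !nth_default.
Qed.

Lemma vstrip_size mu : vstrip mu la -> (size mu <= l)%N.
Proof.
move=> mu_la; rewrite leqNgt; apply/negP => l_mu.
have /andP[/andP[_ mu0] _] := mu_la.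
have := vstrip_nth l mu_la; rewrite [nth _ la _]nth_default // leqn0 => /andP[/eqP mu_l _].
by case/negP: mu0; rewrite -mu_l mem_nth.
Qed.

Lemma vstripP mu : vstrip mu la <-> exists2 e, strip_dec e & mu = strip_seq e.
Proof.
split=> [mu_la|[e e_dec ->]].
  pose e : {ffun 'I_l -> bool} := [ffun i : 'I_l => (nth 0 mu i < nth 0 la i)%N].
  have eE i : strip_fun e i = nth 0%N mu i.
    rewrite !ffunE; have /andP[] := vstrip_nth i mu_la.
    by case: ltnP => /=; lia.
  have mu_part : is_part mu by case/andP: mu_la.
  exists e.
    apply/forallP=> i; apply/forallP=> j; apply/implyP=> /eqP ji.
    by rewrite !eE sorted_nth_dec ?part_sorted // ji.
  rewrite /strip_seq; have -> : [seq strip_fun e i | i <- enum 'I_l] = mu ++ nseq (l - size mu) 0%N.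
    apply: (@eq_from_nth _ 0%N) => [|i].
      by rewrite size_map size_enum_ord size_cat size_nseq subnKC // vstrip_size.
    rewrite size_map size_enum_ord => i_l.
    rewrite nth_strip_fun (insubT (fun k => k < l)%N i_l) eE /= nth_cat.
    by case: ltnP => // ?; rewrite nth_nseq if_same nth_default.
  rewrite filter_cat (all_filterP _) ?filter_nseq ?cats0 //.
  apply/allP=> x x_mu; rewrite lt0n; apply: contraTneq x_mu => ->.
  by case/andP: mu_part.
apply/andP; split; first exact: strip_part.
apply/forallP=> i; have [i_l|l_i] := ltnP i l.
  rewrite -[val i]/(val (Ordinal i_l)) nth_strip_seq // ffunE [part_fun _ _ _]ffunE /=.
  by case: (e _); lia.
by rewrite !nth_default // (leq_trans (size_strip_seq e)).
Qed.

Lemma strip_inj : {in strip_dec &, injective strip_seq}.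
Proof.
move=> e e' e_dec e'_dec ee'; apply/ffunP=> i.
have := nth_strip_seq i e_dec; rewrite ee' nth_strip_seq // !ffunE.
have := part_fun_gt0 i; rewrite ffunE.
by case: (e i); case: (e' i) => //=; lia.
Qed.

Lemma sum_vstrip (F : seq nat -> algC) :
  \sum_(0 <= m < (sumn la).+1) \sum_(mu <- parts m | vstrip mu la) F mu
  = \sum_(e | strip_dec e) F (strip_seq e).
Proof.
transitivity (\sum_(m < (sumn la).+1) \sum_(e | strip_dec e && (sumn (strip_seq e) == m)) F (strip_seq e)).
  rewrite big_mkord; apply: eq_bigr => m _.
  pose P := [pred e | strip_dec e && (sumn (strip_seq e) == m)].
  rewrite -big_filter.
  transitivity (\sum_(mu <- [seq strip_seq e | e <- enum P]) F mu); last by rewrite big_map big_enum.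
  apply: perm_big; apply: uniq_perm; first by rewrite filter_uniq ?parts_uniq.
    rewrite map_inj_in_uniq ?enum_uniq // => e e'; rewrite !mem_enum => /andP[? _] /andP[? _].
    exact: strip_inj.
  move=> mu; rewrite mem_filter mem_parts; apply/andP/mapP => [[/vstripP[e e_dec ->]]|[e]].
    by case/andP=> _ e_m; exists e => //; rewrite mem_enum; apply/andP.
  rewrite mem_enum => /andP[e_dec e_m] ->; split; first by apply/vstripP; exists e.
  by rewrite /is_part_of strip_part.
have lt_sum e : (sumn (strip_seq e) < (sumn la).+1)%N by rewrite ltnS -(sumn_strip e) leq_addr.
by rewrite [RHS](partition_big (fun e => Ordinal (lt_sum e)) xpredT).
Qed.

(** The sum over vertical strips extends to all sets e of rows: if the result increases from row i
    to row i + 1, these rows of la are equal and only the upper one lost a box, so [color_sum_jt0]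
    applies. The full sum collapses by [jt_diffE]. *)
Lemma X_color_sum n (s : 'S_n) :
  X la s = \sum_(t <- subs (cyc s)) color_sum (jt_diff (part_fun l la)) t [ffun=> 0%N].
Proof.
rewrite /X sum_vstrip.
transitivity (\sum_(e : {ffun 'I_l -> bool}) (-1) ^+ (\sum_i e i) *
    \sum_(t <- subs (cyc s)) color_sum (jt (strip_fun e)) t [ffun=> 0%N] : algC).
  rewrite big_mkcond; apply: eq_bigr => e _; case: ifP => [e_dec|/negbT].
    have e_sum := sumn_strip e.
    rewrite (@Y_color_sum l) ?strip_part ?size_strip_seq // part_fun_strip //.
    by rewrite -{1}e_sum addKn.
  rewrite negb_forall => /existsP[i]; rewrite negb_forall => /existsP[j].
  rewrite negb_imply -ltnNge => /andP[/eqP ji e_ij].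
  have e_eq : strip_fun e j = (strip_fun e i).+1.
    have la_ij : (part_fun l la j <= part_fun l la i)%N.
      by apply: part_fun_dec => //; rewrite -/(val j) ji.
    move: e_ij (part_fun_gt0 i) la_ij; rewrite !ffunE.
    by case: (e i); case: (e j) => /=; lia.
  by rewrite [X in _ * X]big1 ?mulr0 // => t _; apply: (color_sum_jt0 _ ji e_eq).
under eq_bigr do rewrite mulr_sumr.
rewrite exchange_big; apply: eq_bigr => t _; rewrite color_sum_lin.
by apply: eq_color_sum => b _; rewrite jt_diffE //; apply: part_fun_gt0.
Qed.

(** The bound on n makes la[n] weakly decreasing, so its alpha is irreducible. Coloured with one
    more colour, the cycles of s have contents of sum n, as [jt_border] requires. *)
Lemma X_irr n : (sumn la + nth 0 la 0 <= n)%N ->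
  exists i : Iirr (Sgrp n), forall s : 'S_n, X la s = 'chi_i s.
Proof.
move=> la_n; pose nu : seq nat := (n - sumn la)%N :: la.
have nu_sorted : sorted geq nu.
  move: (part_sorted la_part) la_n; rewrite /nu; case: (la) => //= x v -> ?.
  by rewrite andbT /geq /=; lia.
pose nuf := part_fun l.+1 nu.
have nuf_sum : (\sum_i nuf i)%N = n.
  by rewrite (@sum_part_fun nu l.+1) //= subnK // (leq_trans _ la_n) // leq_addr.
(* For la empty and n = 0 the sequence nu is [[:: 0]], which is not a partition in the sense of
   [is_part]; sortedness suffices. *)
have nuf_dec (i j : 'I_l.+1) : (i <= j)%N -> (nuf j <= nuf i)%N.
  by move=> ij; rewrite ![nuf _]ffunE sorted_nth_dec.
have [i alpha_i] := alphaCF_irr nuf_dec nuf_sum; exists i => s.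
rewrite -alpha_i alphaCFE /alpha sum_pfix_cyc X_color_sum.
have a0 : [ffun=> 0%N] = [ffun i : 'I_l => [ffun=> 0%N] (lift (@ord0 l) i)] :> {ffun 'I_l -> nat}.
  by apply/ffunP=> k; rewrite !ffunE.
rewrite a0 subs_color_sum; apply: eq_color_sum => b b_sum.
rewrite jt_border.
  by congr (jt_diff _ _); apply/ffunP=> k; rewrite !ffunE.
rewrite b_sum nuf_sum big1 => [|k _]; last by rewrite ffunE.
by rewrite add0n sumn_cyc.
Qed.

End VerticalStrips.

(** * Positivity *)

Definition incr n k (t : k.-tuple 'I_n) : bool := sorted (relpre val ltn) t.

Lemma NidE k n (s : 'S_n) :
  (Nid k s)%:R = \sum_(t : k.-tuple 'I_n) (incr t)%:R * (incr (map_tuple s t))%:R :> algC.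
Proof.
rewrite /Nid -sum1_card natr_sum big_mkcond; apply: eq_bigr => t _.
by rewrite inE /incr [sorted _ (map_tuple s t)]sorted_map; case: (sorted _ t) => /=;
   rewrite ?mul0r // mul1r; case: sorted.
Qed.

Lemma map_tuple_perm_bij k n (s : 'S_n) :
  bijective (fun t : k.-tuple 'I_n => map_tuple s t).
Proof.
exists (fun t => map_tuple s^-1%g t) => t; apply: eq_from_tnth => i.
  by rewrite !tnth_map permK.
by rewrite !tnth_map permKV.
Qed.

(* Nid k is the matrix coefficient s |-> <v, s v> of the sum v of the
   increasing k-tuples, hence of positive type: replacing chi_i by a multiple
   of chi_i * conj chi_i turns the sum into a sum of squared norms. *)
Lemma sum_irr_Nid_ge0 k n (i : Iirr (Sgrp n)) :
  0 <= \sum_(s : 'S_n) 'chi_i s * (Nid k s)%:R.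
Proof.
pose c : algC := 'chi_i 1%g / #|Sgrp n|%:R.
have c_ge0 : 0 <= c by rewrite divr_ge0 ?ler0n // ltW // irr1_gt0.
have chiE (y : 'S_n) : 'chi_i y = c * \sum_(x : 'S_n) 'chi_i (x * y)%g * ('chi_i x)^*.
  have := generalized_orthogonality_relation y i i; rewrite eqxx mul1r => h.
  rewrite /c -mulrA [X in _ * (_ * X)](eq_bigl (fun x => x \in Sgrp n)) => [|x]; last by rewrite inE.
  under [X in _ * (_ * X)]eq_bigr do rewrite -irr_inv.
  by rewrite h mulrCA mulfV ?mulr1 ?irr1_neq0.
pose v (u : k.-tuple 'I_n) := \sum_(z : 'S_n) 'chi_i z * (incr (map_tuple z u))%:R.
suff -> : \sum_(s : 'S_n) 'chi_i s * (Nid k s)%:R = c * \sum_u v u * (v u)^*.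
  by rewrite mulr_ge0 // sumr_ge0 // => u _; rewrite mul_conjC_ge0.
transitivity (c * \sum_(x : 'S_n) \sum_(y : 'S_n) 'chi_i (x * y)%g * ('chi_i x)^* * (Nid k y)%:R).
  rewrite exchange_big mulr_sumr /=; apply: eq_bigr => y _.
  by rewrite {1}chiE -mulr_suml mulrA.
congr (_ * _); transitivity (\sum_(x : 'S_n) \sum_(z : 'S_n) \sum_(u : k.-tuple 'I_n)
    'chi_i z * (incr (map_tuple z u))%:R * ('chi_i x * (incr (map_tuple x u))%:R)^*).
  apply: eq_bigr => x _; rewrite [RHS](reindex_inj (mulgI x)) /=.
  apply: eq_bigr => y _; rewrite NidE mulr_sumr.
  (* Translating the tuple by x turns the two conditions into ones on the translates of u by x and
     by x * y, which separates the variables. *)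
  rewrite (reindex _ (onW_bij _ (map_tuple_perm_bij k x))) /=.
  apply: eq_bigr => u _; rewrite rmorphM /= rmorph_nat.
  have -> : map_tuple y (map_tuple x u) = map_tuple (x * y)%g u.
    by apply: eq_from_tnth => j; rewrite !tnth_map permM.
  by rewrite [X in _ * X = _]mulrC mulrACA.
under eq_bigr do rewrite exchange_big /=.
rewrite exchange_big /=; apply: eq_bigr => u _.
rewrite /v rmorph_sum mulr_suml /= exchange_big /=.
by apply: eq_bigr => z _; rewrite mulr_sumr.
Qed.

(** The code of x :: v is 2^x (2 code(v) + 1). The first part is counted twice on the left, which 2x
    <= 2^x absorbs. *)
Lemma code_ge (la : seq nat) : (sumn la + nth 0 la 0 <= CodeSeq.code la)%N.
Proof.
have codeE x v : CodeSeq.code (x :: v) = (2 ^ x * (CodeSeq.code v).*2.+1)%N by [].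
have sumn_le v : (sumn v <= CodeSeq.code v)%N.
  elim: v => // x v; rewrite codeE /=; have := ltn_expl x (ltnSn 1).
  by move: (2 ^ x)%N (CodeSeq.code v) => p q; nia.
case: la => // x v; rewrite codeE /=; have := sumn_le v.
have : (2 * x <= 2 ^ x)%N by case: x => // x; rewrite expnS leq_mul2l /= ltn_expl.
have : (0 < 2 ^ x)%N by rewrite expn_gt0.
by move: (2 ^ x)%N (CodeSeq.code v) => p q; nia.
Qed.

Theorem corollary1p10 :
  exists2 t : seq nat -> nat, computable t &
    forall la : seq nat, is_part la ->
    forall n k : nat, (t la <= k)%N -> (k <= n)%N -> 0 <= A la n k.
Proof.
exists CodeSeq.code.
  exists (fun v => tnth v ord0); last by [].
  exact: (@rec_proj 1 ord0).
move=> la la_part n k la_k k_n.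
have [i X_i] := X_irr la_part (leq_trans (code_ge la) (leq_trans la_k k_n)).
rewrite /A mulr_ge0 ?invr_ge0 ?ler0n //.
under eq_bigr do rewrite X_i.
exact: sum_irr_Nid_ge0.
Qed.
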